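(* Let $I=[0,1]$ and, for $j\in\{1,2\}$, let $\Phi_j:(-a_j,a_j)\to\mathbb{R}$ be an increasing odd homeomorphism with $0<a_j\leq+\infty$ and let $f_j:[0,\infty)\times[0,\infty)\to[0,\infty)$ be a continuous function. Consider the problem $$\begin{cases}(\Phi_1(x_1'(t)))'+f_1(x_1(t),x_2(t))=0,& t\in I,\\(\Phi_2(x_2'(t)))'+f_2(x_1(t),x_2(t))=0,& t\in I,\\ x_1'(0)=x_1(1)=0=x_2'(0)=x_2(1).\end{cases}\qquad(\ast)$$ Suppose that, for both $j\in\{1,2\}$, there exist $r_j,R_j>0$ with $2r_j<R_j$ such that $$\Phi_j^{-1}\left(\tfrac12m_j^r\right)>\tfrac83r_j\quad\text{and}\quad\Phi_j^{-1}\left(M_j^R\right)<R_j,$$ where $$m_j^r=\min\left\{f_j(x_1,x_2):\tfrac{r_j}{2}\leq x_j\leq2r_j,\ \tfrac{r_k}{2}\leq x_k\leq R_k\ (k\neq j)\right\},$$ $$M_j^R=\max\{f_j(x_1,x_2):0\leq x_1\leq R_1,\ 0\leq x_2\leq R_2\}.$$ Then the problem $(\ast)$ has at least one positive solution $(x_1,x_2)\in\mathcal{K}$ such that $\int_0^1x_j(t)\,dt>r_j$ and $\|x_j\|_\infty<R_j$ for $j=1,2$.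
   Context: $\mathcal{K}:=\mathcal{K}_1\times\mathcal{K}_2$ with $\mathcal{K}_j:=\{u\in\mathcal{C}(I;[0,\infty)):u\text{ is concave and nonincreasing}\}$, and $\|x\|_\infty=\max_{t\in I}|x(t)|$. A solution of $(\ast)$ is a pair $(x_1,x_2)$ of $\mathcal{C}^1$ functions on $I$ with $x_j'(t)\in(-a_j,a_j)$ for all $t\in I$ and $\Phi_j\circ x_j'\in\mathcal{C}^1(I)$, satisfying the equations and boundary conditions; solutions in $\mathcal{K}$ correspond to the fixed points in $\mathcal{K}$ of $\mathcal{T}=(\mathcal{T}_1,\mathcal{T}_2)$, $\mathcal{T}_j(x_1,x_2)(t)=\int_t^1\Phi_j^{-1}\left(\int_0^sf_j(x_1(\tau),x_2(\tau))\,d\tau\right)ds$. Positive means that both components are nonnegative and not identically zero. *)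

(* Defs.v *)
From Stdlib Require Import Reals.
From Coquelicot Require Import Coquelicot.
Open Scope R_scope.

(* Functions on a subset D of R (or of R * R) are total functions of which only
   the values on D matter: continuity is [continuous_on D], and differentiability
   on D is Stdlib's [D_in], the limit of the difference quotients taken along D
   (hence one-sided at the endpoints of an interval). *)

Definition unit_interval (t : R) : Prop := 0 <= t <= 1.

Definition sym_interval (a : Rbar) (u : R) : Prop :=
  Rbar_lt (Rbar_opp a) u /\ Rbar_lt u a.

Definition quadrant (p : R * R) : Prop := 0 <= fst p /\ 0 <= snd p.

(* [PhiInv] is the inverse of [Phi]; the other conditions determine it. *)
Record increasing_odd_homeo (a : Rbar) (Phi PhiInv : R -> R) : Prop := {
  homeo_inv_dom : forall y, sym_interval a (PhiInv y);
  homeo_inv_r : forall y, Phi (PhiInv y) = y;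
  homeo_inv_l : forall u, sym_interval a u -> PhiInv (Phi u) = u;
  homeo_continuous : continuous_on (sym_interval a) Phi;
  homeo_inv_continuous : forall y, continuous PhiInv y;
  homeo_increasing : forall u v,
    sym_interval a u -> sym_interval a v -> u < v -> Phi u < Phi v;
  homeo_odd : forall u, sym_interval a u -> Phi (- u) = - Phi u
}.

(* A continuous map [0, +oo) x [0, +oo) -> [0, +oo). *)
Definition continuous_nonneg_on_quadrant (f : R -> R -> R) : Prop :=
  continuous_on quadrant (fun p : R * R => f (fst p) (snd p)) /\
  (forall u v, 0 <= u -> 0 <= v -> 0 <= f u v).

Definition is_minimum (A : R -> Prop) (m : R) : Prop :=
  A m /\ forall v, A v -> m <= v.

Definition is_maximum (A : R -> Prop) (m : R) : Prop :=
  A m /\ forall v, A v -> v <= m.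

Definition values_on_box (f : R -> R -> R) (l1 u1 l2 u2 : R) (v : R) : Prop :=
  exists x1 x2, l1 <= x1 <= u1 /\ l2 <= x2 <= u2 /\ v = f x1 x2.

Definition is_sup_norm (x : R -> R) (N : R) : Prop :=
  is_maximum (fun v => exists t, unit_interval t /\ v = Rabs (x t)) N.

(* [x] is of class C^1 on [0, 1], with derivative [dx]. *)
Definition C1_with_derivative (x dx : R -> R) : Prop :=
  (forall t, unit_interval t -> D_in x dx unit_interval t) /\
  continuous_on unit_interval dx.

(* [x] solves (Phi (x'))' + g = 0 on [0, 1] with x'(0) = 0 = x(1). *)
Definition solves_scalar_problem
    (a : Rbar) (Phi g x : R -> R) : Prop :=
  exists dx w : R -> R,
    C1_with_derivative x dx /\
    (forall t, unit_interval t -> sym_interval a (dx t)) /\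
    C1_with_derivative (fun t => Phi (dx t)) w /\
    (forall t, unit_interval t -> w t + g t = 0) /\
    dx 0 = 0 /\ x 1 = 0.

Definition solves_system (a1 a2 : Rbar) (Phi1 Phi2 : R -> R)
    (f1 f2 : R -> R -> R) (x1 x2 : R -> R) : Prop :=
  solves_scalar_problem a1 Phi1 (fun t => f1 (x1 t) (x2 t)) x1 /\
  solves_scalar_problem a2 Phi2 (fun t => f2 (x1 t) (x2 t)) x2.

Definition concave_on_unit_interval (x : R -> R) : Prop :=
  forall s t c, unit_interval s -> unit_interval t -> 0 <= c <= 1 ->
    c * x s + (1 - c) * x t <= x (c * s + (1 - c) * t).

Definition nonincreasing_on_unit_interval (x : R -> R) : Prop :=
  forall s t, unit_interval s -> unit_interval t -> s <= t -> x t <= x s.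

Definition in_cone (x : R -> R) : Prop :=
  continuous_on unit_interval x /\
  (forall t, unit_interval t -> 0 <= x t) /\
  concave_on_unit_interval x /\
  nonincreasing_on_unit_interval x.

Definition nonneg_nonzero (x : R -> R) : Prop :=
  (forall t, unit_interval t -> 0 <= x t) /\
  (exists t, unit_interval t /\ x t <> 0).

(* Main.v *)
Require Import Defs.
From Stdlib Require Import ZArith Reals Lra Lia.
From Coquelicot Require Import Coquelicot.
From mathcomp Require boolp filter.
Open Scope R_scope.

(** The system is solved by shooting in the two unknowns c1 = x1(0) and
    c2 = x2(0), so that the only topological input is the Poincare-Miranda
    theorem in dimension two. A solution with x_j'(0) = 0 satisfies
    x_j' = - q_j (w_j), w_j' = f_j (x1, x2), w_j(0) = 0, where q_j is the inverse
    of Phi_j, and c has to be chosen such that x1(1) = x2(1) = 0.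

    Two modifications of the system make the boundary inequalities visible.
    First, f_j is composed with the projection onto the box [0, R1] x [0, R2],
    which makes it continuous on the plane with values in [0, M_j]. Secondly, x_j
    is replaced, as an argument of f_1 and f_2, by its maximum with (1 - t) c_j
    ([envelope]). If c_j = R_j, then x_j(1) >= R_j - q_j(M_j) > 0. If c_j = r_j,
    then on [0, 1/2] the arguments of f_j lie in the box that defines m_j, hence
    w_j >= m_j / 2 on [1/2, 1] and x_j(1) <= r_j - q_j(m_j / 2) / 2 < 0. So there
    is a c in [r1, R1] x [r2, R2] with x1(1) = x2(1) = 0. For this c the function
    x_j is concave with x_j(0) = c_j and x_j(1) = 0, hence x_j(t) >= (1 - t) c_j:
    the modifications are invisible along the solution.

    The bound on the mean follows from concavity if c_j > 2 r_j, since then the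
    integral of x_j is at least c_j / 2. If c_j <= 2 r_j, the argument of the
    lower boundary applies again, w_j >= m_j / 2 on [1/2, 1], and the integral of
    x_j is at least 3/8 q_j(m_j / 2) > r_j ([profile_mean_bound]).

    As f_j is only continuous, the initial value problem may have many solutions
    and shooting cannot be applied to it directly. It is applied to the Euler
    scheme with step 1 / (2 (i + 1)), which depends continuously on c
    ([approximate_shooting]), and i tends to infinity along a free ultrafilter of
    indices. The ultrafilter plays the part of an Arzela-Ascoli subsequence:
    equi-Lipschitz grid functions have a limit ([grid_limit_exists]), limits
    commute with continuous operations ([grid_limit_comp_2]), and the difference
    equations become differential equations ([grid_limit_derivative]). *)

(** * The Poincare-Miranda theorem on a rectangle, approximate form *)

(** The label of a grid point records the first of two functions that is
    positive there. *)
Inductive sign_label := First_pos | Second_pos | None_pos.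

Definition crosses (a b : sign_label) : bool :=
  match a, b with
  | Second_pos, None_pos | None_pos, Second_pos => true
  | _, _ => false
  end.

(** Along the closed walk around a square, the number of edges that join
    [Second_pos] to [None_pos] is even as long as [First_pos] does not occur. *)
Lemma odd_square_is_complete a b c d :
  xorb (xorb (crosses a b) (crosses c d)) (xorb (crosses a c) (crosses b d)) = true ->
  forall l, l = a \/ l = b \/ l = c \/ l = d.
Proof. destruct a, b, c, d; simpl; intros H l; try discriminate H; destruct l; tauto. Qed.

Fixpoint column_crossings (L : nat -> nat -> sign_label) (i m : nat) : bool :=
  match m with
  | O => false
  | S m => xorb (column_crossings L i m) (crosses (L i m) (L i (S m)))
  end.

(** A form of Sperner's lemma for squares. If no square contained all three
    labels, each would have an even number of crossing edges, and the parity of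
    the number of crossings would be the same in all columns: the horizontal
    edges on the bottom and top sides never cross. But it is odd on the left
    side, which runs from [None_pos] to [Second_pos] without meeting [First_pos],
    and zero on the right side. *)
Lemma complete_square_exists (L : nat -> nat -> sign_label) (N : nat) :
  (forall j, (j <= N)%nat -> L 0%nat j <> First_pos) ->
  (forall j, (j <= N)%nat -> L N j = First_pos) ->
  (forall i, (i <= N)%nat -> L i 0%nat <> Second_pos) ->
  (forall i, (i <= N)%nat -> L i N <> None_pos) ->
  exists i j, (i < N)%nat /\ (j < N)%nat /\
    forall l, l = L i j \/ l = L (S i) j \/ l = L i (S j) \/ l = L (S i) (S j).
Proof.
intros Hleft Hright Hbot Htop.
apply Classical_Prop.NNPP. intro Hno.
assert (Hsq : forall i, (i < N)%nat -> forall m, (m <= N)%nat ->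
  xorb (column_crossings L i m) (column_crossings L (S i) m) =
  xorb (crosses (L i 0%nat) (L (S i) 0%nat)) (crosses (L i m) (L (S i) m))).
{ intros i Hi m. induction m as [|m IH]; intros Hm.
  - simpl. destruct (crosses _ _); reflexivity.
  - assert (Heven : xorb (xorb (crosses (L i m) (L (S i) m)) (crosses (L i (S m)) (L (S i) (S m))))
        (xorb (crosses (L i m) (L i (S m))) (crosses (L (S i) m) (L (S i) (S m)))) = false).
    { apply Bool.not_true_is_false. intro E. apply Hno.
      exists i, m. repeat split; [exact Hi|lia|]. apply odd_square_is_complete, E. }
    specialize (IH ltac:(lia)). simpl. revert IH Heven.
    generalize (column_crossings L i m) (column_crossings L (S i) m).
    generalize (crosses (L i 0%nat) (L (S i) 0%nat)) (crosses (L i m) (L (S i) m))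
      (crosses (L i (S m)) (L (S i) (S m))) (crosses (L i m) (L i (S m)))
      (crosses (L (S i) m) (L (S i) (S m))).
    intros [] [] [] [] [] [] []; simpl; congruence. }
assert (Hcol : forall i, (i <= N)%nat -> column_crossings L i N = column_crossings L 0 N).
{ induction i as [|i IH]; intros Hi; [reflexivity|].
  rewrite <- IH by lia. specialize (Hsq i ltac:(lia) N (le_n N)).
  pose proof (Hbot i ltac:(lia)). pose proof (Hbot (S i) ltac:(lia)).
  pose proof (Htop i ltac:(lia)). pose proof (Htop (S i) ltac:(lia)).
  revert Hsq. destruct (column_crossings L i N), (column_crossings L (S i) N);
  destruct (L i 0%nat), (L (S i) 0%nat), (L i N), (L (S i) N); simpl; congruence. }
assert (Hfirst : forall m, (m <= N)%nat -> column_crossings L 0 m = crosses (L 0%nat 0%nat) (L 0%nat m)).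
{ induction m as [|m IH]; intros Hm; simpl.
  - destruct (L 0%nat 0%nat); reflexivity.
  - rewrite IH by lia. pose proof (Hleft 0%nat ltac:(lia)).
    pose proof (Hleft m ltac:(lia)). pose proof (Hleft (S m) Hm).
    destruct (L 0%nat 0%nat), (L 0%nat m), (L 0%nat (S m)); simpl; congruence. }
assert (Hlast : forall m, (m <= N)%nat -> column_crossings L N m = false).
{ induction m as [|m IH]; intros Hm; simpl; [reflexivity|].
  rewrite IH, !Hright by lia. reflexivity. }
specialize (Hcol N (le_n N)). rewrite Hlast, Hfirst in Hcol by lia.
pose proof (Hleft 0%nat ltac:(lia)). pose proof (Hbot 0%nat ltac:(lia)).
pose proof (Hleft N ltac:(lia)). pose proof (Htop 0%nat ltac:(lia)).
destruct (L 0%nat 0%nat), (L 0%nat N); simpl in Hcol; congruence.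
Qed.

Definition label_of (u v : R) : sign_label :=
  if Rlt_dec 0 u then First_pos else if Rlt_dec 0 v then Second_pos else None_pos.

(** In a square with all three labels both functions change sign; if the mesh is
    fine, uniform continuity makes them small on the whole square. *)
Lemma approximate_common_zero (F1 F2 : R -> R -> R) a1 b1 a2 b2 :
  a1 < b1 -> a2 < b2 ->
  (forall x y, a1 <= x <= b1 -> a2 <= y <= b2 -> continuity_2d_pt F1 x y) ->
  (forall x y, a1 <= x <= b1 -> a2 <= y <= b2 -> continuity_2d_pt F2 x y) ->
  (forall y, a2 <= y <= b2 -> F1 a1 y <= 0) ->
  (forall y, a2 <= y <= b2 -> 0 < F1 b1 y) ->
  (forall x, a1 <= x <= b1 -> F2 x a2 <= 0) ->
  (forall x, a1 <= x <= b1 -> 0 < F2 x b2) ->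
  forall eps, 0 < eps -> exists x y, a1 <= x <= b1 /\ a2 <= y <= b2 /\
    Rabs (F1 x y) < eps /\ Rabs (F2 x y) < eps.
Proof.
intros Hab1 Hab2 C1 C2 Hl Hr Hb Ht eps Heps.
destruct (uniform_continuity_2d F1 a1 b1 a2 b2 C1 (mkposreal _ Heps)) as [d1 U1].
destruct (uniform_continuity_2d F2 a1 b1 a2 b2 C2 (mkposreal _ Heps)) as [d2 U2].
simpl in U1, U2.
set (d := Rmin d1 d2).
assert (Hd : 0 < d) by (apply Rmin_glb_lt; apply cond_pos).
assert (Hd1 : d <= d1) by apply Rmin_l.
assert (Hd2 : d <= d2) by apply Rmin_r.
(* One bound for the mesh sizes in both directions. *)
set (w := (b1 - a1) + (b2 - a2)).
destruct (archimed_cor1 (d / w)) as [N [HN HN0]]; [apply Rdiv_lt_0_compat; unfold w; lra|].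
assert (HNpos : 0 < INR N) by (apply lt_0_INR; exact HN0).
assert (HNw : w * / INR N < d).
{ apply Rmult_lt_compat_l with (r := w) in HN; [|unfold w; lra].
  replace (w * (d / w)) with d in HN by (field; unfold w; lra). exact HN. }
set (px := fun i => a1 + INR i * ((b1 - a1) * / INR N)).
set (py := fun j => a2 + INR j * ((b2 - a2) * / INR N)).
assert (HiN : 0 < / INR N) by (apply Rinv_0_lt_compat; exact HNpos).
assert (s1 : 0 < (b1 - a1) * / INR N < d).
{ split; [apply Rmult_lt_0_compat; lra|]. unfold w in HNw.
  assert (0 < (b2 - a2) * / INR N) by (apply Rmult_lt_0_compat; lra). lra. }
assert (s2 : 0 < (b2 - a2) * / INR N < d).
{ split; [apply Rmult_lt_0_compat; lra|]. unfold w in HNw.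
  assert (0 < (b1 - a1) * / INR N) by (apply Rmult_lt_0_compat; lra). lra. }
assert (ex : px N = b1) by (unfold px; field; lra).
assert (ey : py N = b2) by (unfold py; field; lra).
assert (ex0 : px 0%nat = a1) by (unfold px; simpl; ring).
assert (ey0 : py 0%nat = a2) by (unfold py; simpl; ring).
assert (Hpx : forall i, (i <= N)%nat -> a1 <= px i <= b1).
{ intros i Hi. apply le_INR in Hi. pose proof (pos_INR i). rewrite <- ex. unfold px.
  split; [|apply Rplus_le_compat_l, Rmult_le_compat_r; lra].
  assert (0 <= INR i * ((b1 - a1) * / INR N)) by (apply Rmult_le_pos; lra). lra. }
assert (Hpy : forall j, (j <= N)%nat -> a2 <= py j <= b2).
{ intros i Hi. apply le_INR in Hi. pose proof (pos_INR i). rewrite <- ey. unfold py.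
  split; [|apply Rplus_le_compat_l, Rmult_le_compat_r; lra].
  assert (0 <= INR i * ((b2 - a2) * / INR N)) by (apply Rmult_le_pos; lra). lra. }
destruct (complete_square_exists (fun i j => label_of (F1 (px i) (py j)) (F2 (px i) (py j))) N)
  as [i [j [Hi [Hj Hsq]]]].
- intros j Hj. rewrite ex0. unfold label_of. specialize (Hl _ (Hpy j Hj)).
  destruct Rlt_dec; [lra|]. destruct Rlt_dec; congruence.
- intros j Hj. rewrite ex. unfold label_of. specialize (Hr _ (Hpy j Hj)).
  destruct Rlt_dec; [reflexivity|lra].
- intros i Hi. rewrite ey0. unfold label_of. specialize (Hb _ (Hpx i Hi)).
  destruct Rlt_dec; [congruence|]. destruct Rlt_dec; [lra|congruence].
- intros i Hi. rewrite ey. unfold label_of. specialize (Ht _ (Hpx i Hi)).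
  destruct Rlt_dec; [congruence|]. destruct Rlt_dec; [congruence|lra].
- assert (Hcorner : forall l, exists x y, a1 <= x <= b1 /\ a2 <= y <= b2 /\
     Rabs (x - px i) < d /\ Rabs (y - py j) < d /\ l = label_of (F1 x y) (F2 x y)).
  { assert (dx : px (S i) - px i = (b1 - a1) * / INR N) by (unfold px; rewrite S_INR; ring).
    assert (dy : py (S j) - py j = (b2 - a2) * / INR N) by (unfold py; rewrite S_INR; ring).
    intros l. destruct (Hsq l) as [E|[E|[E|E]]]; 
    [exists (px i), (py j)|exists (px (S i)), (py j)|exists (px i), (py (S j))|exists (px (S i)), (py (S j))];
    repeat (split; [first [apply Hpx; lia | apply Hpy; lia | apply Rabs_def1; lra]|]); exact E. }
  destruct (Hcorner First_pos) as [x [y [Hx [Hy [Dx [Dy E]]]]]].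
  destruct (Hcorner Second_pos) as [x' [y' [Hx' [Hy' [Dx' [Dy' E']]]]]].
  destruct (Hcorner None_pos) as [x'' [y'' [Hx'' [Hy'' [Dx'' [Dy'' E'']]]]]].
  assert (Hi' := Hpx i ltac:(lia)). assert (Hj' := Hpy j ltac:(lia)).
  exists (px i), (py j). split; [exact Hi'|]. split; [exact Hj'|].
  pose proof (U1 _ _ _ _ Hi' Hj' Hx Hy ltac:(lra) ltac:(lra)) as V1.
  pose proof (U1 _ _ _ _ Hi' Hj' Hx' Hy' ltac:(lra) ltac:(lra)) as V1'.
  pose proof (U2 _ _ _ _ Hi' Hj' Hx' Hy' ltac:(lra) ltac:(lra)) as V2'.
  pose proof (U2 _ _ _ _ Hi' Hj' Hx'' Hy'' ltac:(lra) ltac:(lra)) as V2''.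
  apply Rabs_def2 in V1, V1', V2', V2''.
  unfold label_of in E, E', E''.
  destruct (Rlt_dec 0 (F1 x y)); [|destruct (Rlt_dec 0 (F2 x y)); discriminate].
  destruct (Rlt_dec 0 (F1 x' y')); [discriminate|].
  destruct (Rlt_dec 0 (F2 x' y')); [|discriminate].
  destruct (Rlt_dec 0 (F1 x'' y'')); [discriminate|].
  destruct (Rlt_dec 0 (F2 x'' y'')); [discriminate|].
  split; apply Rabs_def1; lra.
Qed.

(** * Free ultrafilters on the natural numbers *)

Record free_ultrafilter (U : (nat -> Prop) -> Prop) : Prop := {
  ultra_proper : ProperFilter U;
  ultra_dichotomy : forall P, U P \/ U (fun i => ~ P i);
  ultra_free : forall N, U (fun i => (N <= i)%nat)
}.

(** Obtained by refining the filter of the sets with finite complement. *)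
Lemma free_ultrafilter_exists : exists U, free_ultrafilter U.
Proof.
assert (Hev : @filter.ProperFilter nat Hierarchy.eventually).
{ constructor.
  - intros [N HN]. exact (HN N (le_n N)).
  - constructor.
    + exists 0%nat. intros; exact I.
    + intros P Q [N HN] [N' HN']. exists (N + N')%nat. intros n Hn.
      split; [apply HN | apply HN']; lia.
    + intros P Q HPQ [N HN]. exists N. intros n Hn. apply HPQ, HN, Hn. }
destruct (@filter.ultraFilterLemma nat _ Hev) as [U [HU Hsub]].
assert (HP : filter.ProperFilter U) by (apply filter.ultra_proper).
assert (HF : filter.Filter U) by (apply filter.filter_filter).
exists U. constructor.
- constructor.
  + intros P HUP. apply Classical_Prop.NNPP. intro Hno.
    apply (filter.filter_not_empty U).
    apply (@filter.filterS _ U _ P); [|exact HUP].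
    intros i Hi. apply Hno. exists i. exact Hi.
  + constructor.
    * apply filter.filterT.
    * intros P Q HP' HQ. exact (@filter.filterI _ U _ P Q HP' HQ).
    * intros P Q HPQ HP'. exact (@filter.filterS _ U _ P Q HPQ HP').
- intros P. exact (filter.in_ultra_setVsetC P HU).
- intros N. apply Hsub. exists N. intros n Hn; exact Hn.
Qed.

(** The limit along [U] of a bounded sequence, as the supremum of the numbers that
    are at most [u i] for [U]-almost all [i]; this formula makes it a function of
    the sequence without any choice. *)
Definition ultralimit (U : (nat -> Prop) -> Prop) (u : nat -> R) : R :=
  real (Lub_Rbar (fun x => U (fun i => x <= u i))).

(** The set of indices where [u i >= l + eps / 2] is not in [U], by the choice
    of [l], so that its complement is. *)
Lemma ultralimit_correct U (u : nat -> R) C :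
  free_ultrafilter U -> U (fun i => Rabs (u i) <= C) ->
  filterlim u U (locally (ultralimit U u)).
Proof.
intros [HP Hdich _] Hb.
pose proof (@filter_filter _ _ HP) as HF.
unfold ultralimit. set (E := fun x => U (fun i => x <= u i)).
destruct (Lub_Rbar_correct E) as [Hub Hleast].
assert (HleC : Rbar_le (Lub_Rbar E) C).
{ apply Hleast. intros x Hx.
  destruct (filter_ex _ (filter_and _ _ Hb Hx)) as [i [H1 H2]].
  apply Rabs_le_between in H1. simpl. lra. }
assert (HgeC : Rbar_le (- C) (Lub_Rbar E)).
{ apply Hub. refine (filter_imp _ _ _ Hb). intros i H. apply Rabs_le_between in H. lra. }
destruct (Lub_Rbar E) as [l| |]; simpl in *; try contradiction.
apply filterlim_locally. intros [eps Heps].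
assert (Hlo : U (fun i => l - eps / 2 <= u i)).
{ apply Classical_Prop.NNPP. intro Hno.
  cut (l <= l - eps / 2); [lra|]. apply (Hleast (Finite (l - eps / 2))). intros x Hx. simpl.
  destruct (Rle_or_lt x (l - eps / 2)) as [|Hlt]; [assumption|].
  exfalso. apply Hno. refine (filter_imp _ _ _ Hx). intros i; lra. }
assert (Hhi : U (fun i => ~ (l + eps / 2 <= u i))).
{ destruct (Hdich (fun i => l + eps / 2 <= u i)) as [H|H]; [|exact H].
  exfalso. pose proof (Hub _ H) as H'. simpl in H'. lra. }
refine (filter_imp _ _ _ (filter_and _ _ Hlo Hhi)).
intros i [H1 H2]. apply Rabs_def1; simpl;
unfold minus, plus, opp; simpl; lra.
Qed.

(** * Limits of grid functions along an ultrafilter *)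

Definition step_size (i : nat) : R := / INR (2 * (i + 1)).

(** The [i]-th grid divides the unit interval into an even number of steps, so that
    [1 / 2] is a node of all grids. *)
Definition node (i k : nat) : R := INR k / INR (2 * (i + 1)).

(** Continuous convergence of the functions [A i] on the grids to [a]: the nodes
    are allowed to approach [t] together with the values. This is what makes the
    notion stable under continuous operations and implies that [a] is
    continuous. *)
Definition grid_limit (U : (nat -> Prop) -> Prop) (A : nat -> nat -> R) (a : R -> R) : Prop :=
  forall t eps, unit_interval t -> 0 < eps -> exists delta, 0 < delta /\
    U (fun i => forall k, (k <= 2 * (i + 1))%nat -> Rabs (node i k - t) < delta ->
      Rabs (A i k - a t) < eps).

Lemma steps_pos i : 0 < INR (2 * (i + 1)).
Proof. apply lt_0_INR. lia. Qed.

Lemma node_in_unit_interval i k : (k <= 2 * (i + 1))%nat -> unit_interval (node i k).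
Proof.
intros Hk. pose proof (steps_pos i). unfold node, unit_interval. apply le_INR in Hk.
pose proof (pos_INR k). split.
- apply Rmult_le_reg_r with (INR (2 * (i + 1))); [assumption|]. field_simplify; lra.
- apply Rmult_le_reg_r with (INR (2 * (i + 1))); [assumption|]. field_simplify; lra.
Qed.

Lemma step_size_pos i : 0 < step_size i.
Proof. apply Rinv_0_lt_compat, steps_pos. Qed.

Lemma node_eq i k : node i k = INR k * step_size i.
Proof. reflexivity. Qed.

Lemma node_0 i : node i 0 = 0.
Proof. unfold node. simpl (INR 0). unfold Rdiv. ring. Qed.

Lemma node_S i k : node i (S k) = node i k + step_size i.
Proof. rewrite !node_eq, S_INR. ring. Qed.

Lemma node_last i : node i (2 * (i + 1)) = 1.
Proof. unfold node. field. pose proof (steps_pos i). lra. Qed.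

Lemma node_middle i : node i (i + 1) = / 2.
Proof.
unfold node. rewrite mult_INR. simpl (INR 2). field.
apply not_0_INR. lia.
Qed.

Lemma node_le i k l : (k <= l)%nat -> node i k <= node i l.
Proof.
intros H. rewrite !node_eq. apply Rmult_le_compat_r; [left; apply step_size_pos|].
apply le_INR, H.
Qed.

Lemma node_diff i k k' : node i k' - node i k = (INR k' - INR k) * step_size i.
Proof. rewrite !node_eq. ring. Qed.

Lemma mesh_small U d : free_ultrafilter U -> 0 < d -> U (fun i => step_size i < d).
Proof.
intros HU Hd. destruct (archimed_cor1 d Hd) as [N [HN HN0]].
pose proof (ultra_proper _ HU). refine (filter_imp _ _ _ (ultra_free _ HU N)).
intros i Hi. apply Rle_lt_trans with (/ INR N); [|exact HN].
apply Rinv_le_contravar; [apply lt_0_INR; lia|]. apply le_INR. lia.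
Qed.

Definition left_index (i : nat) (t : R) : nat := Z.to_nat (Int_part (t * INR (2 * (i + 1)))).

Lemma left_index_spec i t : unit_interval t ->
  (left_index i t <= 2 * (i + 1))%nat /\
  node i (left_index i t) <= t < node i (left_index i t) + step_size i.
Proof.
intros [H0 H1]. pose proof (steps_pos i) as Hp.
set (n := INR (2 * (i + 1))) in *.
destruct (base_Int_part (t * n)) as [Hk1 Hk2].
assert (Hnonneg : (0 <= Int_part (t * n))%Z).
{ cut (-1 < Int_part (t * n))%Z; [lia|]. apply lt_IZR.
  assert (0 <= t * n) by (apply Rmult_le_pos; lra). lra. }
assert (Hk : INR (left_index i t) = IZR (Int_part (t * n))).
{ unfold left_index. fold n. rewrite INR_IZR_INZ, Z2Nat.id; [reflexivity|exact Hnonneg]. }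
unfold node, step_size. rewrite Hk. fold n. split; [|split].
- apply INR_le. rewrite Hk. fold n. apply Rle_trans with (t * n); [exact Hk1 |].
  apply Rle_trans with (1 * n); [apply Rmult_le_compat_r; lra |].
  rewrite Rmult_1_l. apply Rle_refl.
- apply Rmult_le_reg_r with n; [assumption|].
  replace (IZR (Int_part (t * n)) / n * n) with (IZR (Int_part (t * n))) by (field; lra).
  exact Hk1.
- apply Rmult_lt_reg_r with n; [assumption|].
  replace ((IZR (Int_part (t * n)) / n + / n) * n) with (IZR (Int_part (t * n)) + 1)
    by (field; lra).
  lra.
Qed.

Lemma Rabs_double_triangle a b c : Rabs (a - c) <= Rabs (a - b) + Rabs (b - c).
Proof. replace (a - c) with ((a - b) + (b - c)) by ring. apply Rabs_triang. Qed.

Lemma increments_bound (u : nat -> R) d k l : (k <= l)%nat ->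
  (forall j, (k <= j < l)%nat -> Rabs (u (S j) - u j) <= d) ->
  Rabs (u l - u k) <= d * (INR l - INR k).
Proof.
intros Hkl. induction Hkl as [|l Hkl IH]; intros H.
- rewrite !Rminus_diag, Rabs_R0. lra.
- pose proof (Rabs_double_triangle (u (S l)) (u l) (u k)).
  specialize (IH ltac:(intros; apply H; lia)). specialize (H l ltac:(lia)).
  rewrite S_INR. lra.
Qed.

(** The compactness theorem: the values at the nodes next to [t] have a limit along
    [U], and the common Lipschitz constant carries it over to all nodes near
    [t]. *)
Lemma grid_limit_exists U A C : free_ultrafilter U ->
  (forall i, Rabs (A i 0%nat) <= C) ->
  (forall i k, (k < 2 * (i + 1))%nat ->
     Rabs (A i (S k) - A i k) <= C * step_size i) ->
  exists a, grid_limit U A a.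
Proof.
intros HU H0 Hstep.
pose proof (ultra_proper _ HU) as HP.
assert (HC : 0 <= C) by (pose proof (H0 0%nat); pose proof (Rabs_pos (A 0%nat 0%nat)); lra).
assert (Hlip : forall i k l, (k <= l <= 2 * (i + 1))%nat ->
  Rabs (A i l - A i k) <= C * Rabs (node i l - node i k)).
{ intros i k l Hkl. rewrite node_diff, (Rabs_pos_eq (_ * _)).
  - assert (H : Rabs (A i l - A i k) <= C * step_size i * (INR l - INR k)).
    { apply increments_bound; [lia|]. intros j Hj. apply Hstep. lia. }
    lra.
  - apply Rmult_le_pos; [|left; apply step_size_pos].
    destruct Hkl as [Hkl _]. apply le_INR in Hkl. lra. }
assert (Hlip' : forall i k l, (k <= 2 * (i + 1))%nat -> (l <= 2 * (i + 1))%nat ->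
  Rabs (A i l - A i k) <= C * Rabs (node i l - node i k)).
{ intros i k l Hk Hl. destruct (Nat.le_ge_cases k l).
  - apply Hlip; lia.
  - rewrite (Rabs_minus_sym (A i l)), (Rabs_minus_sym (node i l)). apply Hlip; lia. }
exists (fun t => ultralimit U (fun i => A i (left_index i t))).
intros t eps Ht Heps.
assert (Hlim : filterlim (fun i => A i (left_index i t)) U
          (locally (ultralimit U (fun i => A i (left_index i t))))).
{ apply ultralimit_correct with (2 * C); [exact HU|].
  apply filter_forall. intros i.
  destruct (left_index_spec i t Ht) as [Hk _].
  pose proof (Hlip' i 0%nat _ ltac:(lia) Hk) as H.
  assert (Rabs (node i (left_index i t) - node i 0) <= 1).
  { destruct (node_in_unit_interval i _ Hk).
    replace (node i 0) with 0 by (unfold node; simpl INR; lra).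
    apply Rabs_le. lra. }
  pose proof (Rabs_triang (A i (left_index i t) - A i 0%nat) (A i 0%nat)) as H2.
  replace (A i (left_index i t) - A i 0%nat + A i 0%nat) with (A i (left_index i t)) in H2 by ring.
  specialize (H0 i). nra. }
set (a := ultralimit _ _) in *. clearbody a.
rewrite filterlim_locally in Hlim.
assert (He2 : 0 < eps / 2) by lra.
specialize (Hlim (mkposreal _ He2)).
set (d := eps / (4 * (C + 1))).
assert (Hd : 0 < d) by (apply Rdiv_lt_0_compat; lra).
exists d. split; [exact Hd|].
refine (filter_imp _ _ _ (filter_and _ _ Hlim (mesh_small _ _ HU Hd))).
intros i [Hb Hm] k Hk Hkt.
change (Rabs (A i (left_index i t) - a) < eps / 2) in Hb.
destruct (left_index_spec i t Ht) as [Hl [Hl1 Hl2]].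
pose proof (Hlip' i _ _ Hl Hk) as H.
assert (Hnn : Rabs (node i k - node i (left_index i t)) <= 2 * d).
{ apply Rabs_def2 in Hkt. apply Rabs_le. lra. }
assert (Hcd : C * (2 * d) <= eps / 2).
{ replace (eps / 2) with ((C + 1) * (2 * d)) by (unfold d; field; lra). nra. }
pose proof (Rabs_double_triangle (A i k) (A i (left_index i t)) a).
pose proof (Rmult_le_compat_l C _ _ HC Hnn). lra.
Qed.

Lemma grid_limit_const U (u : nat -> R) l : ProperFilter U ->
  filterlim u U (locally l) -> grid_limit U (fun i _ => u i) (fun _ => l).
Proof.
intros HP H t eps _ Heps. exists 1. split; [lra|].
refine (filter_imp _ _ _ (proj1 (filterlim_locally u l) H (mkposreal _ Heps))).
intros i Hi k _ _. exact Hi.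
Qed.

Lemma grid_limit_node U : ProperFilter U -> grid_limit U node (fun t => t).
Proof.
intros HP t eps _ Heps. exists eps. split; [exact Heps|].
apply filter_forall. intros i k _ H. exact H.
Qed.

Lemma grid_limit_comp_2 U A B a b (phi : R -> R -> R) : ProperFilter U ->
  grid_limit U A a -> grid_limit U B b ->
  (forall t, unit_interval t -> continuous (fun p : R * R => phi (fst p) (snd p)) (a t, b t)) ->
  grid_limit U (fun i k => phi (A i k) (B i k)) (fun t => phi (a t) (b t)).
Proof.
intros HP HA HB Hphi t eps Ht Heps.
destruct (proj1 (filterlim_locally _ _) (Hphi t Ht) (mkposreal _ Heps)) as [d Hd].
destruct (HA t d Ht (cond_pos d)) as [d1 [Hd1 H1]].
destruct (HB t d Ht (cond_pos d)) as [d2 [Hd2 H2]].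
exists (Rmin d1 d2). split; [apply Rmin_glb_lt; assumption|].
refine (filter_imp _ _ _ (filter_and _ _ H1 H2)). intros i [H1i H2i] k Hk Hkt.
pose proof (Rmin_l d1 d2). pose proof (Rmin_r d1 d2).
apply (Hd (A i k, B i k)). split.
- apply H1i; [exact Hk|lra].
- apply H2i; [exact Hk|lra].
Qed.

Lemma grid_limit_comp U A a (phi : R -> R) : ProperFilter U ->
  grid_limit U A a -> (forall y, continuous phi y) ->
  grid_limit U (fun i k => phi (A i k)) (fun t => phi (a t)).
Proof.
intros HP HA Hphi.
apply (grid_limit_comp_2 U A A a a (fun u _ => phi u) HP HA HA).
intros t _. apply (continuous_comp (fun p : R * R => fst p) phi); [apply continuous_fst | apply Hphi].
Qed.

Lemma grid_limit_at U A a (kappa : nat -> nat) t : ProperFilter U ->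
  grid_limit U A a -> unit_interval t ->
  (forall i, (kappa i <= 2 * (i + 1))%nat) ->
  filterlim (fun i => node i (kappa i)) U (locally t) ->
  filterlim (fun i => A i (kappa i)) U (locally (a t)).
Proof.
intros HP HA Ht Hk Hlim. apply filterlim_locally. intros eps.
destruct (HA t eps Ht (cond_pos eps)) as [d [Hd H]].
pose proof (proj1 (filterlim_locally _ _) Hlim (mkposreal _ Hd)) as H'.
refine (filter_imp _ _ _ (filter_and _ _ H H')). intros i [H1 H2].
apply (H1 _ (Hk i) H2).
Qed.

Lemma left_node_lim U t : free_ultrafilter U -> unit_interval t ->
  filterlim (fun i => node i (left_index i t)) U (locally t).
Proof.
intros HU Ht. pose proof (ultra_proper _ HU). apply filterlim_locally. intros eps.
refine (filter_imp _ _ _ (mesh_small U eps HU (cond_pos eps))). intros i Hi.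
destruct (left_index_spec i t Ht) as [_ [H1 H2]].
apply Rabs_def1; unfold minus, plus, opp; simpl in *; lra.
Qed.

Lemma grid_limit_continuous U A a : free_ultrafilter U ->
  grid_limit U A a -> continuous_on unit_interval a.
Proof.
intros HU HA t Ht. pose proof (ultra_proper _ HU) as HP.
apply filterlim_locally. intros eps.
destruct (HA t (eps / 2) Ht) as [d [Hd H]]; [pose proof (cond_pos eps); lra|].
assert (Hd2 : 0 < d / 2) by lra.
exists (mkposreal _ Hd2). intros s Hs Hsu. change (Rabs (s - t) < d / 2) in Hs.
change (Rabs (a s - a t) < eps).
destruct (HA s (eps / 2) Hsu) as [d' [Hd' H']]; [pose proof (cond_pos eps); lra|].
destruct (filter_ex _ (filter_and _ _ (filter_and _ _ H H')
  (filter_and _ _ (mesh_small U _ HU Hd2) (mesh_small U _ HU Hd')))) as [i [[Hi Hi'] [Hm Hm']]].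
destruct (left_index_spec i s Hsu) as [Hk [H1 H2]].
apply Rabs_def2 in Hs.
assert (E1 := Hi _ Hk ltac:(apply Rabs_def1; lra)).
assert (E2 := Hi' _ Hk ltac:(apply Rabs_def1; lra)).
apply Rabs_def2 in E1, E2. apply Rabs_def1; lra.
Qed.

(** Euler sums converge to a primitive. Near [t] every increment of [A i] differs from
    [b t * step_size i] by at most [eps / 2 * step_size i]; summing between the nodes
    next to [s] and to [t] and passing to the limit bounds the difference quotient. *)
Lemma grid_limit_derivative U A B a b : free_ultrafilter U ->
  grid_limit U A a -> grid_limit U B b ->
  (forall i k, (k < 2 * (i + 1))%nat -> A i (S k) = A i k + step_size i * B i k) ->
  forall t, unit_interval t -> D_in a b unit_interval t.
Proof.
intros HU HA HB Hstep t Ht eps Heps. pose proof (ultra_proper _ HU) as HP.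
destruct (HB t (eps / 2) Ht) as [d [Hd H]]; [lra|].
exists (d / 2). split; [lra|]. intros s [[Hs Hne] Hst].
change (Rabs (s - t) < d / 2) in Hst.
change (Rabs ((a s - a t) / (s - t) - b t) < eps).
assert (Hpos : 0 < Rabs (s - t)) by (apply Rabs_pos_lt; lra).
set (D := a s - a t - (s - t) * b t).
assert (Hmain : Rabs D <= eps / 2 * Rabs (s - t)).
{ apply le_epsilon. intros zeta Hzeta.
  (* [eta * K] bounds the total error made by passing from [s] and [t] to nodes. *)
  set (K := eps + 2 + 2 * Rabs (b t)).
  assert (HK : 0 < K) by (pose proof (Rabs_pos (b t)); unfold K; lra).
  set (eta := Rmin (zeta / K) (d / 2)).
  assert (Heta : 0 < eta) by (apply Rmin_glb_lt; [apply Rdiv_lt_0_compat|]; lra).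
  assert (Heta2 : eta * K <= zeta).
  { replace zeta with (zeta / K * K) by (field; lra).
    apply Rmult_le_compat_r; [lra|apply Rmin_l]. }
  assert (Heta3 : eta <= d / 2) by apply Rmin_r.
  pose proof (grid_limit_at U A a _ s HP HA Hs (fun i => proj1 (left_index_spec i s Hs))
                (left_node_lim U s HU Hs)) as Ls.
  pose proof (grid_limit_at U A a _ t HP HA Ht (fun i => proj1 (left_index_spec i t Ht))
                (left_node_lim U t HU Ht)) as Lt.
  pose proof (proj1 (filterlim_locally _ _) Ls (mkposreal _ Heta)) as Es.
  pose proof (proj1 (filterlim_locally _ _) Lt (mkposreal _ Heta)) as Et.
  destruct (filter_ex _ (filter_and _ _ (filter_and _ _ Es Et)
    (filter_and _ _ H (mesh_small U _ HU Heta)))) as [i [[Eis Eit] [Hi Hm]]].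
  change (Rabs (A i (left_index i s) - a s) < eta) in Eis.
  change (Rabs (A i (left_index i t) - a t) < eta) in Eit.
  destruct (left_index_spec i s Hs) as [Hl [Hl1 Hl2]].
  destruct (left_index_spec i t Ht) as [Hk [Hk1 Hk2]].
  revert Eis Eit Hl Hl1 Hl2 Hk Hk1 Hk2.
  generalize (left_index i s) (left_index i t). intros l k Eis Eit Hl Hl1 Hl2 Hk Hk1 Hk2.
  (* Subtracting the linear part turns the claim into a bound on small increments. *)
  set (u := fun j => A i j - node i j * b t).
  assert (Hu : forall k l, (k <= l)%nat -> (l <= 2 * (i + 1))%nat ->
     (forall j, (k <= j < l)%nat -> Rabs (node i j - t) < d) ->
     Rabs (u l - u k) <= eps / 2 * (node i l - node i k)).
  { clear -Hi Hstep. intros k l Hkl Hl Hj. rewrite node_diff.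
    assert (Hincr : Rabs (u l - u k) <= eps / 2 * step_size i * (INR l - INR k)).
    { apply increments_bound; [exact Hkl|]. intros j Hjkl.
      replace (u (S j) - u j) with (step_size i * (B i j - b t)).
      - rewrite Rabs_mult, Rabs_pos_eq by (left; apply step_size_pos).
        rewrite (Rmult_comm (eps / 2)).
        apply Rmult_le_compat_l; [left; apply step_size_pos|].
        left. apply Hi; [lia|]. apply Hj. exact Hjkl.
      - unfold u. rewrite Hstep by lia.
        rewrite node_S. ring. }
    lra. }
  assert (Hlk : Rabs (u l - u k) <= eps / 2 * Rabs (node i l - node i k)).
  { apply Rabs_def2 in Hst. destruct (Nat.le_ge_cases k l) as [Hkl|Hkl].
    - rewrite (Rabs_pos_eq (node i l - node i k)) by (pose proof (node_le i k l Hkl); lra).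
      apply Hu; [exact Hkl|exact Hl|]. intros j Hj.
      pose proof (node_le i k j ltac:(lia)). pose proof (node_le i j l ltac:(lia)).
      apply Rabs_def1; lra.
    - rewrite Rabs_minus_sym, (Rabs_minus_sym (node i l)).
      rewrite (Rabs_pos_eq (node i k - node i l)) by (pose proof (node_le i l k Hkl); lra).
      apply Hu; [exact Hkl|exact Hk|]. intros j Hj.
      pose proof (node_le i l j ltac:(lia)). pose proof (node_le i j k ltac:(lia)).
      apply Rabs_def1; lra. }
  assert (Hnodes : Rabs (node i l - node i k) <= Rabs (s - t) + eta).
  { pose proof (Rabs_le_between (s - t) (Rabs (s - t))) as [Hb _].
    specialize (Hb (Rle_refl _)). apply Rabs_le. lra. }
  replace D with ((a s - A i l) + (u l - u k) + (A i k - a t)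
     + ((node i l - s) - (node i k - t)) * b t) by (unfold D, u; ring).
  assert (T1 : Rabs (((node i l - s) - (node i k - t)) * b t) <= eta * Rabs (b t)).
  { rewrite Rabs_mult. apply Rmult_le_compat_r; [apply Rabs_pos|]. apply Rabs_le. lra. }
  rewrite (Rabs_minus_sym _ (a s)) in Eis.
  pose proof (Rabs_triang (a s - A i l) (u l - u k)).
  pose proof (Rabs_triang (a s - A i l + (u l - u k)) (A i k - a t)).
  pose proof (Rabs_triang (a s - A i l + (u l - u k) + (A i k - a t))
               (((node i l - s) - (node i k - t)) * b t)).
  assert (eps / 2 * Rabs (node i l - node i k) <= eps / 2 * (Rabs (s - t) + eta))
    by (apply Rmult_le_compat_l; lra).
  assert (0 <= eta * Rabs (b t)) by (apply Rmult_le_pos; [lra|apply Rabs_pos]).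
  assert (0 <= eps * eta) by (apply Rmult_le_pos; lra).
  unfold K in Heta2. lra. }
replace ((a s - a t) / (s - t) - b t) with (D / (s - t)) by (unfold D; field; lra).
unfold Rdiv at 1. rewrite Rabs_mult, Rabs_inv.
apply Rmult_lt_reg_r with (Rabs (s - t)); [exact Hpos|].
rewrite Rmult_assoc, Rinv_l by lra. nra.
Qed.

(** * The Euler scheme *)

Definition nondecreasing (q : R -> R) : Prop := forall u v, u <= v -> q u <= q v.

Definition euler_sequence (i : nat) (q : R -> R) (c : R) (g X W : nat -> R) : Prop :=
  X 0%nat = c /\ W 0%nat = 0 /\
  (forall k, X (S k) = X k - step_size i * q (W k)) /\
  (forall k, W (S k) = W k + step_size i * g k).

Lemma euler_moment_bounds i q c g X W M : euler_sequence i q c g X W ->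
  (forall k, 0 <= g k <= M) -> forall k, 0 <= W k <= node i k * M.
Proof.
intros [_ [HW0 [_ HW]]] Hg. pose proof (step_size_pos i).
induction k as [|k IH].
- rewrite HW0, node_0. lra.
- rewrite HW, node_S. specialize (Hg k).
  assert (0 <= step_size i * g k) by (apply Rmult_le_pos; lra).
  assert (step_size i * g k <= step_size i * M) by (apply Rmult_le_compat_l; lra).
  lra.
Qed.

Lemma euler_nonincreasing i q c g X W M : nondecreasing q -> q 0 = 0 ->
  euler_sequence i q c g X W -> (forall k, 0 <= g k <= M) ->
  forall k l, (k <= l)%nat -> X l <= X k.
Proof.
intros Hq Hq0 HE Hg k l Hkl. induction Hkl as [|l Hkl IH]; [lra|].
destruct (euler_moment_bounds _ _ _ _ _ _ _ HE Hg l) as [H _].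
apply Hq in H. pose proof (step_size_pos i).
destruct HE as [_ [_ [HX _]]]. rewrite HX.
assert (0 <= step_size i * q (W l)) by (apply Rmult_le_pos; lra). lra.
Qed.

(** The sign condition on the upper sides of the shooting rectangle. *)
Lemma euler_final_lower_bound i q c g X W M : nondecreasing q ->
  euler_sequence i q c g X W -> (forall k, 0 <= g k <= M) ->
  c - q M <= X (2 * (i + 1))%nat.
Proof.
intros Hq HE Hg. pose proof (step_size_pos i).
assert (HM : 0 <= M) by (specialize (Hg 0%nat); lra).
assert (H' : forall k, (k <= 2 * (i + 1))%nat -> c - node i k * q M <= X k).
{ pose proof (euler_moment_bounds _ _ _ _ _ _ _ HE Hg) as HWb.
  destruct HE as [HX0 [_ [HX _]]].
  induction k as [|k IH]; intros Hk.
  - rewrite HX0, node_0. lra.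
  - specialize (IH ltac:(lia)). rewrite HX, node_S.
    destruct (HWb k) as [_ Hb].
    assert (Hn : node i k <= 1) by (rewrite <- (node_last i); apply node_le; lia).
    assert (Hqb : q (W k) <= q M).
    { apply Hq. apply Rle_trans with (node i k * M); [exact Hb|]. nra. }
    assert (step_size i * q (W k) <= step_size i * q M) by (apply Rmult_le_compat_l; lra).
    lra. }
specialize (H' _ (le_n _)). rewrite node_last in H'. lra.
Qed.

(** The sign condition on the lower sides of the shooting rectangle: a forcing of at
    least [m] during the first half of the time makes the moment at least [m / 2],
    and hence the slope at most [- q (m / 2)], during the second half. *)
Lemma euler_final_upper_bound i q c g X W m M : nondecreasing q -> q 0 = 0 ->
  euler_sequence i q c g X W -> (forall k, 0 <= g k <= M) ->
  (forall k, (k < i + 1)%nat -> m <= g k) ->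
  X (2 * (i + 1))%nat <= c - q (m / 2) / 2.
Proof.
intros Hq Hq0 HE Hg Hm. pose proof (step_size_pos i) as Hh.
assert (HW1 : forall k, (k <= i + 1)%nat -> node i k * m <= W k).
{ destruct HE as [_ [HW0 [_ HW]]]. induction k as [|k IH]; intros Hk.
  - rewrite HW0, node_0. lra.
  - specialize (IH ltac:(lia)). rewrite HW, node_S. specialize (Hm k ltac:(lia)).
    assert (step_size i * m <= step_size i * g k) by (apply Rmult_le_compat_l; lra). lra. }
assert (HW2 : forall j, m / 2 <= W (i + 1 + j)%nat).
{ induction j as [|j IH].
  - rewrite Nat.add_0_r. specialize (HW1 _ (le_n _)). rewrite node_middle in HW1. lra.
  - rewrite Nat.add_succ_r. destruct HE as [_ [_ [_ HW]]]. rewrite HW.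
    specialize (Hg (i + 1 + j)%nat).
    assert (0 <= step_size i * g (i + 1 + j)%nat) by (apply Rmult_le_pos; lra). lra. }
assert (HX2 : forall j, X (i + 1 + j)%nat <= c - node i j * q (m / 2)).
{ induction j as [|j IH].
  - rewrite node_0.
    pose proof (euler_nonincreasing _ _ _ _ _ _ _ Hq Hq0 HE Hg 0 (i + 1 + 0) ltac:(lia)) as H.
    destruct HE as [HX0 _]. rewrite HX0 in H. lra.
  - rewrite Nat.add_succ_r, node_S. destruct HE as [_ [_ [HX _]]]. rewrite HX.
    pose proof (Hq _ _ (HW2 j)) as H.
    assert (step_size i * q (m / 2) <= step_size i * q (W (i + 1 + j)%nat))
      by (apply Rmult_le_compat_l; lra). lra. }
specialize (HX2 (i + 1)%nat). rewrite node_middle in HX2.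
replace (2 * (i + 1))%nat with (i + 1 + (i + 1))%nat by lia. lra.
Qed.

(** A concave function on the unit interval that vanishes at [1] and has the value
    [c] at [0] lies above [(1 - t) * c]; imposing this bound on the arguments of the
    nonlinearities leaves the desired solutions unchanged. *)
Definition envelope (c t x : R) : R := Rmax x ((1 - t) * c).

(** The state is [((x1, w1), (x2, w2))]. *)
Fixpoint euler_scheme (q1 q2 : R -> R) (F1 F2 : R -> R -> R) (i : nat) (c1 c2 : R) (k : nat)
  : (R * R) * (R * R) :=
  match k with
  | O => ((c1, 0), (c2, 0))
  | S k =>
      let s := euler_scheme q1 q2 F1 F2 i c1 c2 k in
      let y1 := envelope c1 (node i k) (fst (fst s)) in
      let y2 := envelope c2 (node i k) (fst (snd s)) in
      ((fst (fst s) - step_size i * q1 (snd (fst s)), snd (fst s) + step_size i * F1 y1 y2),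
       (fst (snd s) - step_size i * q2 (snd (snd s)), snd (snd s) + step_size i * F2 y1 y2))
  end.

Definition continuous_2 (F : R -> R -> R) : Prop :=
  forall p : R * R, continuous (fun p : R * R => F (fst p) (snd p)) p.

Lemma Rmax_continuous : continuous_2 Rmax.
Proof.
intros [a b]. apply filterlim_locally. intros eps.
exists eps. intros [a' b'] [Ha Hb].
change (Rabs (a' - a) < eps) in Ha. change (Rabs (b' - b) < eps) in Hb.
change (Rabs (Rmax a' b' - Rmax a b) < eps).
apply Rabs_def2 in Ha, Hb. apply Rabs_def1;
unfold Rmax; destruct (Rle_dec a b), (Rle_dec a' b'); lra.
Qed.

Lemma envelope_continuous {T : UniformSpace} (c t x : T -> R) p :
  continuous c p -> continuous t p -> continuous x p ->
  continuous (fun p => envelope (c p) (t p) (x p)) p.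
Proof.
intros Hc Ht Hx. unfold envelope.
apply (continuous_comp_2 x (fun p => (1 - t p) * c p) Rmax); [exact Hx| |apply Rmax_continuous].
apply (continuous_mult (K := R_AbsRing)); [|exact Hc].
apply (continuous_minus (V := R_NormedModule)); [apply continuous_const|exact Ht].
Qed.

Lemma euler_scheme_continuous q1 q2 F1 F2 i k :
  (forall y, continuous q1 y) -> (forall y, continuous q2 y) ->
  continuous_2 F1 -> continuous_2 F2 ->
  let s := fun c : R * R => euler_scheme q1 q2 F1 F2 i (fst c) (snd c) k in
  forall c, (continuous (fun c => fst (fst (s c))) c /\ continuous (fun c => snd (fst (s c))) c) /\
            (continuous (fun c => fst (snd (s c))) c /\ continuous (fun c => snd (snd (s c))) c).
Proof.
intros Hq1 Hq2 HF1 HF2 s c.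
induction k as [|k [[IX1 IW1] [IX2 IW2]]].
- split; split; unfold s; simpl; first [apply continuous_fst | apply continuous_snd | apply continuous_const].
- set (s' := fun c : R * R => euler_scheme q1 q2 F1 F2 i (fst c) (snd c) k) in *.
  cbv zeta in *.
  assert (Hsub : forall (q : R -> R) (X W : R * R -> R), (forall y, continuous q y) -> continuous X c -> continuous W c ->
     continuous (fun c : R * R => X c - step_size i * q (W c)) c).
  { intros q X W Hq HX HW. apply (continuous_minus (V := R_NormedModule)); [exact HX|].
    apply (continuous_mult (K := R_AbsRing)); [apply continuous_const|].
    apply (continuous_comp W q); [exact HW|apply Hq]. }
  assert (Hy1 : continuous (fun c : R * R => envelope (fst c) (node i k) (fst (fst (s' c)))) c).
  { apply envelope_continuous; [apply continuous_fst|apply continuous_const|exact IX1]. }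
  assert (Hy2 : continuous (fun c : R * R => envelope (snd c) (node i k) (fst (snd (s' c)))) c).
  { apply envelope_continuous; [apply continuous_snd|apply continuous_const|exact IX2]. }
  assert (Hadd : forall F (W : R * R -> R), continuous_2 F -> continuous W c ->
     continuous (fun c : R * R => W c + step_size i *
        F (envelope (fst c) (node i k) (fst (fst (s' c)))) (envelope (snd c) (node i k) (fst (snd (s' c))))) c).
  { intros F W HF HW. apply (continuous_plus (V := R_NormedModule)); [exact HW|].
    apply (continuous_mult (K := R_AbsRing)); [apply continuous_const|].
    apply (continuous_comp_2 _ _ F); [exact Hy1|exact Hy2|apply HF]. }
  split; split; unfold s; simpl.
  + apply (Hsub q1 _ _ Hq1 IX1 IW1).
  + apply (Hadd F1 _ HF1 IW1).
  + apply (Hsub q2 _ _ Hq2 IX2 IW2).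
  + apply (Hadd F2 _ HF2 IW2).
Qed.

(** * Shooting and passage to the limit *)

Record admissible (q : R -> R) (F : R -> R -> R) (M : R) : Prop := {
  adm_monotone : nondecreasing q;
  adm_zero : q 0 = 0;
  adm_continuous : forall y, continuous q y;
  adm_forcing_continuous : continuous_2 F;
  adm_forcing_bounds : forall u v, 0 <= F u v <= M
}.

Lemma euler_scheme_components q1 q2 F1 F2 i c1 c2 :
  let s := euler_scheme q1 q2 F1 F2 i c1 c2 in
  let y1 := fun k => envelope c1 (node i k) (fst (fst (s k))) in
  let y2 := fun k => envelope c2 (node i k) (fst (snd (s k))) in
  euler_sequence i q1 c1 (fun k => F1 (y1 k) (y2 k))
    (fun k => fst (fst (s k))) (fun k => snd (fst (s k))) /\
  euler_sequence i q2 c2 (fun k => F2 (y1 k) (y2 k))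
    (fun k => fst (snd (s k))) (fun k => snd (snd (s k))).
Proof. split; repeat split. Qed.

Lemma envelope_range r c t x : 0 < r <= c -> t <= / 2 -> x <= c -> 0 <= t ->
  r / 2 <= envelope c t x <= c.
Proof.
intros Hc Ht Hx H0. unfold envelope. split.
- apply Rle_trans with ((1 - t) * c); [nra|apply Rmax_r].
- apply Rmax_lub; nra.
Qed.

Lemma early_node i k : (k < i + 1)%nat -> 0 <= node i k <= / 2.
Proof.
intros Hk. split.
- apply node_in_unit_interval. lia.
- rewrite <- (node_middle i). apply node_le. lia.
Qed.

(** The endpoint map of the Euler scheme is continuous in the shooting parameters and
    has the signs required by [approximate_common_zero] on the four sides. *)
Lemma approximate_shooting q1 q2 F1 F2 M1 M2 m1 m2 r1 R1 r2 R2 i eps :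
  admissible q1 F1 M1 -> admissible q2 F2 M2 ->
  0 < r1 < R1 -> 0 < r2 < R2 ->
  (forall u v, r1 / 2 <= u <= r1 -> r2 / 2 <= v -> m1 <= F1 u v) ->
  (forall u v, r1 / 2 <= u -> r2 / 2 <= v <= r2 -> m2 <= F2 u v) ->
  2 * r1 <= q1 (m1 / 2) -> 2 * r2 <= q2 (m2 / 2) ->
  q1 M1 < R1 -> q2 M2 < R2 -> 0 < eps ->
  exists c1 c2, r1 <= c1 <= R1 /\ r2 <= c2 <= R2 /\
    let s := euler_scheme q1 q2 F1 F2 i c1 c2 (2 * (i + 1)) in
    Rabs (fst (fst s)) < eps /\ Rabs (fst (snd s)) < eps.
Proof.
intros A1 A2 Hr1 Hr2 Hm1 Hm2 Hlow1 Hlow2 Hup1 Hup2 Heps.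
pose proof (euler_scheme_continuous q1 q2 F1 F2 i (2 * (i + 1))
  (adm_continuous _ _ _ A1) (adm_continuous _ _ _ A2)
  (adm_forcing_continuous _ _ _ A1) (adm_forcing_continuous _ _ _ A2)) as Hcont.
cbv zeta in Hcont.
apply (approximate_common_zero
  (fun c1 c2 => fst (fst (euler_scheme q1 q2 F1 F2 i c1 c2 (2 * (i + 1)))))
  (fun c1 c2 => fst (snd (euler_scheme q1 q2 F1 F2 i c1 c2 (2 * (i + 1))))));
  try lra; try exact Heps.
- intros x y _ _. apply continuity_2d_pt_filterlim. apply (proj1 (Hcont (x, y))).
- intros x y _ _. apply continuity_2d_pt_filterlim. apply (proj2 (Hcont (x, y))).
- intros c2 Hc2. destruct (euler_scheme_components q1 q2 F1 F2 i r1 c2) as [E1 E2].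
  cbv zeta in E1, E2. destruct A1 as [P1 P2 P3 P4 P5], A2 as [Q1 Q2 Q3 Q4 Q5].
  pose proof (euler_nonincreasing _ _ _ _ _ _ _ P1 P2 E1 (fun k => P5 _ _)) as D1.
  apply (euler_final_upper_bound _ _ _ _ _ _ m1 M1) in E1; auto; [cbv beta in E1; lra|].
  intros k Hk. pose proof (early_node i k Hk). apply Hm1.
  + apply envelope_range; try lra. apply (D1 0%nat k); lia.
  + apply Rle_trans with ((1 - node i k) * c2); [nra|apply Rmax_r].
- intros c2 Hc2. destruct (euler_scheme_components q1 q2 F1 F2 i R1 c2) as [E1 _].
  apply (euler_final_lower_bound _ _ _ _ _ _ M1) in E1; [cbv beta zeta in E1; lra|apply A1|].
  intros k. apply (adm_forcing_bounds _ _ _ A1).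
- intros c1 Hc1. destruct (euler_scheme_components q1 q2 F1 F2 i c1 r2) as [E1 E2].
  cbv zeta in E1, E2. destruct A1 as [P1 P2 P3 P4 P5], A2 as [Q1 Q2 Q3 Q4 Q5].
  pose proof (euler_nonincreasing _ _ _ _ _ _ _ Q1 Q2 E2 (fun k => Q5 _ _)) as D2.
  apply (euler_final_upper_bound _ _ _ _ _ _ m2 M2) in E2; auto; [cbv beta in E2; lra|].
  intros k Hk. pose proof (early_node i k Hk). apply Hm2.
  + apply Rle_trans with ((1 - node i k) * c1); [nra|apply Rmax_r].
  + apply envelope_range; try lra. apply (D2 0%nat k); lia.
- intros c1 Hc1. destruct (euler_scheme_components q1 q2 F1 F2 i c1 R2) as [_ E2].
  apply (euler_final_lower_bound _ _ _ _ _ _ M2) in E2; [cbv beta zeta in E2; lra|apply A2|].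
  intros k. apply (adm_forcing_bounds _ _ _ A2).
Qed.

(** [w] is the negative of the flux [Phi (x')]; keeping it as an unknown turns the
    second-order problem into a first-order system in which [Phi] itself does not
    occur. *)
Record boundary_profile (q g : R -> R) (c : R) (x w : R -> R) : Prop := {
  profile_position : forall t, unit_interval t -> D_in x (fun t => - q (w t)) unit_interval t;
  profile_moment : forall t, unit_interval t -> D_in w g unit_interval t;
  profile_forcing : continuous_on unit_interval g;
  profile_initial : x 0 = c;
  profile_initial_moment : w 0 = 0;
  profile_final : x 1 = 0
}.

Lemma filterlim_real_unique U (u : nat -> R) l l' : ProperFilter U ->
  filterlim u U (locally l) -> filterlim u U (locally l') -> l = l'.
Proof. intros HP. apply (filterlim_locally_unique (V := R_NormedModule)). Qed.

Lemma limit_in_interval U (u : nat -> R) l a b : ProperFilter U ->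
  (forall i, a <= u i <= b) -> filterlim u U (locally l) -> a <= l <= b.
Proof.
intros HP Hab Hl.
assert (Hclose : forall eps, 0 < eps -> exists i, Rabs (u i - l) < eps).
{ intros eps Heps.
  destruct (filter_ex _ (proj1 (filterlim_locally u l) Hl (mkposreal _ Heps))) as [i Hi].
  exists i. exact Hi. }
split; apply Rnot_lt_le; intro Hlt.
- destruct (Hclose (a - l)) as [i Hi]; [lra|]. specialize (Hab i). apply Rabs_def2 in Hi. lra.
- destruct (Hclose (l - b)) as [i Hi]; [lra|]. specialize (Hab i). apply Rabs_def2 in Hi. lra.
Qed.

Lemma euler_grid_limits U q c g X W M :
  free_ultrafilter U -> nondecreasing q -> q 0 = 0 ->
  (exists C, forall i, Rabs (c i) <= C) ->
  (forall i k, 0 <= g i k <= M) ->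
  (forall i, euler_sequence i q (c i) (g i) (X i) (W i)) ->
  exists x w, grid_limit U X x /\ grid_limit U W w.
Proof.
intros HU Hq Hq0 [C HC] Hg HE.
assert (HC0 : 0 <= C) by (pose proof (HC 0%nat); pose proof (Rabs_pos (c 0%nat)); lra).
assert (HM : 0 <= M) by (specialize (Hg 0%nat 0%nat); lra).
assert (HqM : 0 <= q M) by (rewrite <- Hq0; apply Hq, HM).
assert (HX : exists x, grid_limit U X x).
{ apply (grid_limit_exists U X (C + q M) HU).
  - intros i. destruct (HE i) as [H _]. rewrite H. specialize (HC i). lra.
  - intros i k Hk.
    destruct (euler_moment_bounds _ _ _ _ _ _ _ (HE i) (Hg i) k) as [H1 H2].
    destruct (HE i) as [_ [_ [H _]]]. rewrite H.
    pose proof (step_size_pos i) as Hh.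
    assert (0 <= q (W i k)) by (rewrite <- Hq0; apply Hq, H1).
    assert (q (W i k) <= q M).
    { apply Hq. assert (Hn : unit_interval (node i k)) by (apply node_in_unit_interval; lia).
      destruct Hn. nra. }
    replace (X i k - step_size i * q (W i k) - X i k) with (- (step_size i * q (W i k))) by ring.
    rewrite Rabs_Ropp, Rabs_pos_eq by (apply Rmult_le_pos; lra). nra. }
assert (HW : exists w, grid_limit U W w).
{ apply (grid_limit_exists U W M HU).
  - intros i. destruct (HE i) as [_ [H _]]. rewrite H, Rabs_R0. exact HM.
  - intros i k Hk. destruct (HE i) as [_ [_ [_ H]]]. rewrite H. specialize (Hg i k).
    pose proof (step_size_pos i) as Hh.
    replace (W i k + step_size i * g i k - W i k) with (step_size i * g i k) by ring.
    rewrite Rabs_pos_eq by (apply Rmult_le_pos; lra). nra. }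
destruct HX as [x Hx], HW as [w Hw]. exists x, w. split; assumption.
Qed.

Lemma profile_of_euler_limit U q c0 c g gl X W x w :
  free_ultrafilter U -> (forall y, continuous q y) ->
  filterlim c U (locally c0) ->
  (forall i, euler_sequence i q (c i) (g i) (X i) (W i)) ->
  grid_limit U X x -> grid_limit U W w -> grid_limit U g gl ->
  filterlim (fun i => X i (2 * (i + 1))%nat) U (locally 0) ->
  boundary_profile q gl c0 x w.
Proof.
intros HU Hq Hc HE Hx Hw Hg Hend. pose proof (ultra_proper _ HU) as HP.
assert (Hstart : forall A a, grid_limit U A a -> filterlim (fun i => A i 0%nat) U (locally (a 0))).
{ intros A a HA. apply (grid_limit_at U A a (fun _ => 0%nat) 0 HP HA); [split; lra|intros; lia|].
  apply filterlim_ext with (fun _ => 0); [intros i; symmetry; apply node_0|]. apply filterlim_const. }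
constructor.
- apply (grid_limit_derivative U X (fun i k => - q (W i k)) x (fun t => - q (w t)) HU Hx).
  + apply (grid_limit_comp U W w (fun y => - q y) HP Hw).
    intros y. apply (continuous_opp (V := R_NormedModule)). apply Hq.
  + intros i k _. destruct (HE i) as [_ [_ [H _]]]. rewrite H. ring.
- apply (grid_limit_derivative U W g w gl HU Hw Hg).
  intros i k _. destruct (HE i) as [_ [_ [_ H]]]. apply H.
- apply (grid_limit_continuous U g gl HU Hg).
- apply (filterlim_real_unique U (fun i => X i 0%nat)); [exact HP|apply Hstart, Hx|].
  apply filterlim_ext with c; [|exact Hc]. intros i. symmetry. apply (HE i).
- apply (filterlim_real_unique U (fun i => W i 0%nat)); [exact HP|apply Hstart, Hw|].
  apply filterlim_ext with (fun _ => 0); [|apply filterlim_const].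
  intros i. symmetry. apply (HE i).
- apply (filterlim_real_unique U (fun i => X i (2 * (i + 1))%nat)); [exact HP| |exact Hend].
  apply (grid_limit_at U X x (fun i => (2 * (i + 1))%nat) 1 HP Hx); [split; lra|intros; lia|].
  apply filterlim_ext with (fun _ => 1); [intros i; symmetry; apply node_last|]. apply filterlim_const.
Qed.

Lemma grid_limit_envelope U c c0 X x : ProperFilter U ->
  filterlim c U (locally c0) -> grid_limit U X x ->
  grid_limit U (fun i k => envelope (c i) (node i k) (X i k)) (fun t => envelope c0 t (x t)).
Proof.
intros HP Hc HX.
pose proof (grid_limit_const U c c0 HP Hc) as Gc.
assert (G : grid_limit U (fun i k => (1 - node i k) * c i) (fun t => (1 - t) * c0)).
{ apply (grid_limit_comp_2 U node _ (fun t => t) _ (fun t c => (1 - t) * c) HP (grid_limit_node U HP) Gc).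
  intros t _. apply (continuous_mult (K := R_AbsRing)); [|apply continuous_snd].
  apply (continuous_minus (V := R_NormedModule)); [apply continuous_const|apply continuous_fst]. }
apply (grid_limit_comp_2 U X _ x _ Rmax HP HX G). intros t _. apply Rmax_continuous.
Qed.

(** The accuracy demanded of the [i]-th shooting is its step size, so that the limit
    vanishes at [1] exactly. *)
Lemma modified_system_solvable q1 q2 F1 F2 M1 M2 m1 m2 r1 R1 r2 R2 :
  admissible q1 F1 M1 -> admissible q2 F2 M2 ->
  0 < r1 < R1 -> 0 < r2 < R2 ->
  (forall u v, r1 / 2 <= u <= r1 -> r2 / 2 <= v -> m1 <= F1 u v) ->
  (forall u v, r1 / 2 <= u -> r2 / 2 <= v <= r2 -> m2 <= F2 u v) ->
  2 * r1 <= q1 (m1 / 2) -> 2 * r2 <= q2 (m2 / 2) ->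
  q1 M1 < R1 -> q2 M2 < R2 ->
  exists c1 c2 x1 w1 x2 w2, r1 <= c1 <= R1 /\ r2 <= c2 <= R2 /\
    boundary_profile q1 (fun t => F1 (envelope c1 t (x1 t)) (envelope c2 t (x2 t))) c1 x1 w1 /\
    boundary_profile q2 (fun t => F2 (envelope c1 t (x1 t)) (envelope c2 t (x2 t))) c2 x2 w2.
Proof.
intros A1 A2 Hr1 Hr2 Hm1 Hm2 Hlow1 Hlow2 Hup1 Hup2.
destruct free_ultrafilter_exists as [U HU]. pose proof (ultra_proper _ HU) as HP.
assert (Hshoot : forall i, exists c : R * R, r1 <= fst c <= R1 /\ r2 <= snd c <= R2 /\
    let s := euler_scheme q1 q2 F1 F2 i (fst c) (snd c) (2 * (i + 1)) in
    Rabs (fst (fst s)) < step_size i /\ Rabs (fst (snd s)) < step_size i).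
{ intros i.
  destruct (approximate_shooting q1 q2 F1 F2 M1 M2 m1 m2 r1 R1 r2 R2 i (step_size i))
    as [c1 [c2 H]]; try assumption; [apply step_size_pos|].
  exists (c1, c2). exact H. }
apply boolp.choice in Hshoot. destruct Hshoot as [c Hc].
assert (Hlim : forall u a b, (forall i, a <= u i <= b) ->
   filterlim u U (locally (ultralimit U u)) /\ exists C, forall i, Rabs (u i) <= C).
{ intros u a b Hu.
  assert (HC : forall i, Rabs (u i) <= Rabs a + Rabs b).
  { intros i. specialize (Hu i). apply Rabs_le. unfold Rabs. destruct (Rcase_abs a), (Rcase_abs b); lra. }
  split; [|exists (Rabs a + Rabs b); exact HC].
  apply ultralimit_correct with (Rabs a + Rabs b); [exact HU|]. apply filter_forall, HC. }
destruct (Hlim (fun i => fst (c i)) r1 R1) as [L1 B1]; [intros i; apply Hc|].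
destruct (Hlim (fun i => snd (c i)) r2 R2) as [L2 B2]; [intros i; apply Hc|].
clear Hlim.
assert (Hsmall : forall u : nat -> R, (forall i, Rabs (u i) < step_size i) -> filterlim u U (locally 0)).
{ intros u Hu. apply filterlim_locally. intros e.
  refine (filter_imp _ _ _ (mesh_small U e HU (cond_pos e))). intros i Hi.
  change (Rabs (u i - 0) < e). rewrite Rminus_0_r. apply Rlt_trans with (1 := Hu i). exact Hi. }
pose proof (fun i => proj1 (euler_scheme_components q1 q2 F1 F2 i (fst (c i)) (snd (c i)))) as E1.
pose proof (fun i => proj2 (euler_scheme_components q1 q2 F1 F2 i (fst (c i)) (snd (c i)))) as E2.
cbv zeta in E1, E2.
destruct (fun H => euler_grid_limits U q1 _ _ _ _ M1 HU (adm_monotone _ _ _ A1) (adm_zero _ _ _ A1) B1 H E1)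
  as [x1 [w1 [X1 W1]]]; [intros i k; apply (adm_forcing_bounds _ _ _ A1)|].
destruct (fun H => euler_grid_limits U q2 _ _ _ _ M2 HU (adm_monotone _ _ _ A2) (adm_zero _ _ _ A2) B2 H E2)
  as [x2 [w2 [X2 W2]]]; [intros i k; apply (adm_forcing_bounds _ _ _ A2)|].
pose proof (grid_limit_envelope U _ _ _ _ HP L1 X1) as Y1.
pose proof (grid_limit_envelope U _ _ _ _ HP L2 X2) as Y2.
exists (ultralimit U (fun i => fst (c i))), (ultralimit U (fun i => snd (c i))), x1, w1, x2, w2.
split; [apply (limit_in_interval U _ _ _ _ HP (fun i => proj1 (Hc i)) L1)|].
split; [apply (limit_in_interval U _ _ _ _ HP (fun i => proj1 (proj2 (Hc i))) L2)|].
split.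
- apply (profile_of_euler_limit U q1 _ _ _ _ _ _ _ _ HU (adm_continuous _ _ _ A1) L1 E1 X1 W1).
  + apply (grid_limit_comp_2 U _ _ _ _ F1 HP Y1 Y2). intros t _. apply (adm_forcing_continuous _ _ _ A1).
  + apply Hsmall. intros i. apply (Hc i).
- apply (profile_of_euler_limit U q2 _ _ _ _ _ _ _ _ HU (adm_continuous _ _ _ A2) L2 E2 X2 W2).
  + apply (grid_limit_comp_2 U _ _ _ _ F2 HP Y1 Y2). intros t _. apply (adm_forcing_continuous _ _ _ A2).
  + apply Hsmall. intros i. apply (Hc i).
Qed.

(** * Calculus on the unit interval *)

Definition clamp (lo hi x : R) : R := Rmax lo (Rmin hi x).

Lemma clamp_range lo hi x : lo <= hi -> lo <= clamp lo hi x <= hi.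
Proof.
intros H. unfold clamp. split; [apply Rmax_l|]. apply Rmax_lub; [exact H|apply Rmin_l].
Qed.

Lemma clamp_id lo hi x : lo <= x <= hi -> clamp lo hi x = x.
Proof. intros H. unfold clamp. rewrite Rmin_right by lra. apply Rmax_right. lra. Qed.

Lemma clamp_lipschitz lo hi x y : Rabs (clamp lo hi x - clamp lo hi y) <= Rabs (x - y).
Proof.
unfold clamp, Rmax, Rmin.
repeat destruct Rle_dec; unfold Rabs; repeat destruct Rcase_abs; lra.
Qed.

Lemma clamp_filterlim (D : R -> Prop) lo hi t :
  (forall s, D (clamp lo hi s)) ->
  filterlim (clamp lo hi) (locally t) (within D (locally (clamp lo hi t))).
Proof.
intros HD P [eps HP]. exists eps. intros s Hs. apply HP; [|apply HD].
apply Rle_lt_trans with (1 := clamp_lipschitz lo hi s t). exact Hs.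
Qed.

Lemma clamp_unit s : unit_interval (clamp 0 1 s).
Proof. apply clamp_range. lra. Qed.

(** [D_in] gives only one-sided information at the endpoints; composing with the
    projection onto the interval yields a function to which the theorems on
    functions continuous on the line apply. *)
Lemma extension_continuous (x : R -> R) : continuous_on unit_interval x ->
  forall t, continuous (fun s => x (clamp 0 1 s)) t.
Proof.
intros Hx t. apply (filterlim_comp _ _ _ (clamp 0 1) x _ (within unit_interval (locally (clamp 0 1 t)))).
- apply clamp_filterlim, clamp_unit.
- apply Hx, clamp_unit.
Qed.

Lemma D_in_continuous_on x dx : (forall t, unit_interval t -> D_in x dx unit_interval t) ->
  continuous_on unit_interval x.
Proof.
intros H t Ht. apply filterlim_locally. intros eps.
destruct (cont_deriv x dx unit_interval t (H t Ht) eps (cond_pos eps)) as [d [Hd Hcont]].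
exists (mkposreal _ Hd). intros s Hs Hsu. change (Rabs (s - t) < d) in Hs.
change (Rabs (x s - x t) < eps).
destruct (Req_dec s t) as [->|Hne].
- rewrite Rminus_diag, Rabs_R0. apply cond_pos.
- apply Hcont. split; [split; [exact Hsu|congruence]|exact Hs].
Qed.

Lemma mean_value_unit_interval x dx s t :
  (forall u, unit_interval u -> D_in x dx unit_interval u) ->
  0 <= s -> s <= t -> t <= 1 ->
  exists xi, s <= xi <= t /\ x t - x s = dx xi * (t - s).
Proof.
intros H Hs Hst Ht.
destruct (MVT_gen (fun u => x (clamp 0 1 u)) s t dx) as [xi [Hxi E]].
- rewrite Rmin_left, Rmax_right by lra. intros u Hu.
  apply is_derive_Reals. intros eps Heps.
  destruct (H u ltac:(split; lra) eps Heps) as [d [Hd Hlim]].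
  assert (Hd' : 0 < Rmin d (Rmin u (1 - u))) by (repeat apply Rmin_glb_lt; lra).
  exists (mkposreal _ Hd'). intros h Hh0 Hh. simpl in Hh.
  pose proof (Rmin_l d (Rmin u (1 - u))). pose proof (Rmin_r d (Rmin u (1 - u))).
  pose proof (Rmin_l u (1 - u)). pose proof (Rmin_r u (1 - u)).
  assert (Hh' := Hh). apply Rabs_def2 in Hh'.
  rewrite !clamp_id by lra.
  specialize (Hlim (u + h)).
  replace h with (u + h - u) at 2 by ring. apply Hlim. split.
  + split; [split; lra|lra].
  + change (Rabs (u + h - u) < d). replace (u + h - u) with h by ring. lra.
- intros u _. apply continuity_pt_filterlim. apply (extension_continuous x (D_in_continuous_on x dx H) u).
- rewrite Rmin_left, Rmax_right in Hxi by lra. exists xi. split; [exact Hxi|].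
  rewrite !clamp_id in E by lra. exact E.
Qed.

Lemma ex_RInt_continuous_on_unit (x : R -> R) a b : continuous_on unit_interval x ->
  0 <= a -> a <= b -> b <= 1 -> ex_RInt x a b.
Proof.
intros Hx Ha Hab Hb. apply ex_RInt_ext with (fun s => x (clamp 0 1 s)).
- rewrite Rmin_left, Rmax_right by lra. intros u Hu. rewrite clamp_id by lra. reflexivity.
- apply (ex_RInt_continuous (V := R_CompleteNormedModule)). intros u _. apply (extension_continuous x Hx u).
Qed.

Lemma RInt_ge_affine (x : R -> R) a b p k : a <= b -> ex_RInt x a b ->
  (forall t, a < t < b -> p + k * t <= x t) ->
  p * (b - a) + k * (b * b - a * a) / 2 <= RInt x a b.
Proof.
intros Hab Hx Hle.
assert (Haff : is_RInt (fun t => p + k * t) a b (p * (b - a) + k * (b * b - a * a) / 2)).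
{ replace (p * (b - a) + k * (b * b - a * a) / 2)
    with (minus (p * b + k * (b * b) / 2) (p * a + k * (a * a) / 2))
    by (unfold minus, plus, opp; simpl; field).
  apply (is_RInt_derive (fun t => p * t + k * (t * t) / 2) (fun t => p + k * t)).
  - intros t _. auto_derive; [exact I|field].
  - intros t _. apply (continuous_plus (V := R_NormedModule)); [apply continuous_const|].
    apply (continuous_mult (K := R_AbsRing)); [apply continuous_const|apply continuous_id]. }
rewrite <- (is_RInt_unique _ _ _ _ Haff).
apply RInt_le; [exact Hab|eexists; exact Haff|exact Hx|exact Hle].
Qed.

(** * Solutions of the scalar problem *)

Lemma profile_moment_monotone q g c x w M : boundary_profile q g c x w ->
  (forall t, unit_interval t -> 0 <= g t <= M) ->
  forall s t, 0 <= s -> s <= t -> t <= 1 -> w s <= w t /\ 0 <= w t <= M.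
Proof.
intros HB Hg s t Hs Hst Ht.
destruct (mean_value_unit_interval w g s t (profile_moment _ _ _ _ _ HB) Hs Hst Ht) as [xi [Hxi E]].
destruct (mean_value_unit_interval w g 0 t (profile_moment _ _ _ _ _ HB) ltac:(lra) ltac:(lra) Ht)
  as [xi' [Hxi' E']].
rewrite (profile_initial_moment _ _ _ _ _ HB) in E'.
pose proof (Hg xi ltac:(split; lra)). pose proof (Hg xi' ltac:(split; lra)).
split; [nra|]. split; [nra|]. nra.
Qed.

(** [x' = - q w] is nonpositive and nonincreasing because [w] is
    nondecreasing with [w 0 = 0]. *)
Lemma profile_in_cone q g c x w M : nondecreasing q -> q 0 = 0 -> boundary_profile q g c x w ->
  (forall t, unit_interval t -> 0 <= g t <= M) -> in_cone x.
Proof.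
intros Hq Hq0 HB Hg.
pose proof (profile_moment_monotone _ _ _ _ _ _ HB Hg) as Hw.
pose proof (profile_position _ _ _ _ _ HB) as Hx.
assert (Hmono : nonincreasing_on_unit_interval x).
{ intros s t [Hs _] [_ Ht] Hst.
  destruct (mean_value_unit_interval x _ s t Hx Hs Hst Ht) as [xi [Hxi E]].
  destruct (Hw xi xi ltac:(lra) ltac:(lra) ltac:(lra)) as [_ [H _]].
  apply Hq in H. nra. }
assert (Hconc : forall s t c0, unit_interval s -> unit_interval t -> 0 <= c0 <= 1 -> s <= t ->
    c0 * x s + (1 - c0) * x t <= x (c0 * s + (1 - c0) * t)).
{ intros s t c0 [Hs _] [_ Ht] Hc0 Hst. set (z := c0 * s + (1 - c0) * t).
  assert (Hz1 : z - s = (1 - c0) * (t - s)) by (unfold z; ring).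
  assert (Hz2 : t - z = c0 * (t - s)) by (unfold z; ring).
  assert (Hsz : s <= z) by (assert (0 <= (1 - c0) * (t - s)) by (apply Rmult_le_pos; lra); lra).
  assert (Hzt : z <= t) by (assert (0 <= c0 * (t - s)) by (apply Rmult_le_pos; lra); lra).
  destruct (mean_value_unit_interval x _ s z Hx Hs Hsz ltac:(lra)) as [xi [Hxi E]].
  destruct (mean_value_unit_interval x _ z t Hx ltac:(lra) Hzt Ht) as [xi' [Hxi' E']].
  destruct (Hw xi xi' ltac:(lra) ltac:(lra) ltac:(lra)) as [H _]. apply Hq in H.
  rewrite Hz1 in E. rewrite Hz2 in E'.
  assert (Hkey : 0 <= (c0 * (1 - c0) * (t - s)) * (q (w xi') - q (w xi))).
  { apply Rmult_le_pos; [apply Rmult_le_pos; [apply Rmult_le_pos|]|]; lra. }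
  nra. }
split; [apply (D_in_continuous_on _ _ Hx)|]. split; [|split].
- intros t Ht. rewrite <- (profile_final _ _ _ _ _ HB). apply Hmono; [exact Ht|split; lra|apply Ht].
- intros s t c0 Hs Ht Hc0. destruct (Rle_dec s t) as [Hst|Hst]; [apply Hconc; assumption|].
  pose proof (Hconc t s (1 - c0) Ht Hs ltac:(lra) ltac:(lra)) as H.
  replace (1 - (1 - c0)) with c0 in H by ring.
  rewrite Rplus_comm, (Rplus_comm (c0 * s)). exact H.
- exact Hmono.
Qed.

Lemma profile_position_bounds q g c x w M : nondecreasing q -> q 0 = 0 -> boundary_profile q g c x w ->
  (forall t, unit_interval t -> 0 <= g t <= M) ->
  forall t, unit_interval t -> (1 - t) * c <= x t <= c.
Proof.
intros Hq Hq0 HB Hg t Ht.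
destruct (profile_in_cone _ _ _ _ _ _ Hq Hq0 HB Hg) as [_ [_ [Hconc Hmono]]].
rewrite <- (profile_initial _ _ _ _ _ HB). split.
- specialize (Hconc 0 1 (1 - t) ltac:(split; lra) ltac:(split; lra) ltac:(destruct Ht; lra)).
  rewrite (profile_final _ _ _ _ _ HB) in Hconc.
  replace ((1 - t) * 0 + (1 - (1 - t)) * 1) with t in Hconc by ring. lra.
- apply Hmono; [split; lra|exact Ht|apply Ht].
Qed.

Lemma profile_initial_bound q g c x w M : nondecreasing q -> boundary_profile q g c x w ->
  (forall t, unit_interval t -> 0 <= g t <= M) -> c <= q M.
Proof.
intros Hq HB Hg.
destruct (mean_value_unit_interval x _ 0 1 (profile_position _ _ _ _ _ HB)) as [xi [Hxi E]]; try lra.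
rewrite (profile_initial _ _ _ _ _ HB), (profile_final _ _ _ _ _ HB) in E.
destruct (profile_moment_monotone _ _ _ _ _ _ HB Hg xi xi) as [_ [_ H]]; try lra.
apply Hq in H. lra.
Qed.

(** [x] is at least [p / 2] on the first half of the interval and [p * (1 - t)] on the
    second, with [p = q (m / 2)]; the integral of this minorant is
    [p / 4 + p / 8]. *)
Lemma profile_mean_bound q g c x w M m : nondecreasing q -> q 0 = 0 -> boundary_profile q g c x w ->
  (forall t, unit_interval t -> 0 <= g t <= M) ->
  (forall t, 0 <= t <= / 2 -> m <= g t) ->
  3 / 8 * q (m / 2) <= RInt x 0 1.
Proof.
intros Hq Hq0 HB Hg Hm.
pose proof (D_in_continuous_on _ _ (profile_position _ _ _ _ _ HB)) as Hcont.
destruct (profile_in_cone _ _ _ _ _ _ Hq Hq0 HB Hg) as [_ [_ [_ Hmono]]].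
set (p := q (m / 2)).
assert (Hw2 : forall t, / 2 <= t <= 1 -> m / 2 <= w t).
{ intros t Ht.
  destruct (mean_value_unit_interval w g 0 (/ 2) (profile_moment _ _ _ _ _ HB)) as [xi [Hxi E]]; try lra.
  rewrite (profile_initial_moment _ _ _ _ _ HB) in E. specialize (Hm xi Hxi).
  destruct (profile_moment_monotone _ _ _ _ _ _ HB Hg (/ 2) t) as [H _]; lra. }
assert (Hx2 : forall t, / 2 <= t <= 1 -> p * (1 - t) <= x t).
{ intros t Ht.
  destruct (mean_value_unit_interval x _ t 1 (profile_position _ _ _ _ _ HB)) as [xi [Hxi E]]; try lra.
  rewrite (profile_final _ _ _ _ _ HB) in E.
  pose proof (Hq _ _ (Hw2 xi ltac:(lra))) as H. fold p in H. nra. }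
assert (Hx1 : forall t, 0 <= t <= / 2 -> p / 2 <= x t).
{ intros t Ht. specialize (Hx2 (/ 2) ltac:(lra)).
  specialize (Hmono t (/ 2) ltac:(split; lra) ltac:(split; lra) ltac:(lra)). lra. }
pose proof (ex_RInt_continuous_on_unit x 0 (/ 2) Hcont ltac:(lra) ltac:(lra) ltac:(lra)) as I1.
pose proof (ex_RInt_continuous_on_unit x (/ 2) 1 Hcont ltac:(lra) ltac:(lra) ltac:(lra)) as I2.
rewrite <- (RInt_Chasles x 0 (/ 2) 1 I1 I2).
assert (J1 := RInt_ge_affine x 0 (/ 2) (p / 2) 0 ltac:(lra) I1 ltac:(intros t Ht; specialize (Hx1 t ltac:(lra)); lra)).
assert (J2 := RInt_ge_affine x (/ 2) 1 p (- p) ltac:(lra) I2 ltac:(intros t Ht; specialize (Hx2 t ltac:(lra)); lra)).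
change (plus ?a ?b) with (a + b). lra.
Qed.

Lemma homeo_inverse_nondecreasing a Phi q : increasing_odd_homeo a Phi q -> nondecreasing q.
Proof.
intros H u v Huv. apply Rnot_lt_le. intro Hlt.
apply (homeo_increasing _ _ _ H) in Hlt; try apply (homeo_inv_dom _ _ _ H).
rewrite !(homeo_inv_r _ _ _ H) in Hlt. lra.
Qed.

Lemma homeo_inverse_zero a Phi q : Rbar_lt 0 a -> increasing_odd_homeo a Phi q -> q 0 = 0.
Proof.
intros Ha H.
assert (H0 : sym_interval a 0) by (split; [destruct a; simpl in *; lra|exact Ha]).
pose proof (homeo_odd _ _ _ H 0 H0) as Hodd. rewrite Ropp_0 in Hodd.
rewrite <- (homeo_inv_l _ _ _ H 0 H0) at 2. f_equal. lra.
Qed.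

Lemma sym_interval_opp a u : sym_interval a u -> sym_interval a (- u).
Proof. destruct a as [a| |]; intros [H1 H2]; split; simpl in *; lra. Qed.

Lemma profile_solves_scalar_problem a Phi q g G c x w : Rbar_lt 0 a ->
  increasing_odd_homeo a Phi q -> boundary_profile q g c x w ->
  (forall t, unit_interval t -> g t = G t) ->
  solves_scalar_problem a Phi G x.
Proof.
intros Ha Hhom HB HG.
assert (Hflux : forall y, Phi (- q y) = - y).
{ intros y. rewrite (homeo_odd _ _ _ Hhom) by apply (homeo_inv_dom _ _ _ Hhom).
  rewrite (homeo_inv_r _ _ _ Hhom). reflexivity. }
exists (fun t => - q (w t)), (fun t => - g t).
assert (Hopp : forall h : R -> R, continuous_on unit_interval h -> continuous_on unit_interval (fun t => - h t)).
{ intros h Hh t Ht. apply (filterlim_comp _ _ _ h Ropp _ (locally (h t))); [apply Hh, Ht|].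
  apply (filterlim_opp (V := R_NormedModule)). }
split; [split; [apply (profile_position _ _ _ _ _ HB)|]|].
- apply (Hopp (fun t => q (w t))). intros t Ht.
  apply (filterlim_comp _ _ _ w q _ (locally (w t))); [|apply (homeo_inv_continuous _ _ _ Hhom)].
  apply (D_in_continuous_on _ _ (profile_moment _ _ _ _ _ HB) t Ht).
- split; [|split; [split|split; [|split]]].
  + intros t _. apply sym_interval_opp, (homeo_inv_dom _ _ _ Hhom).
  + intros t Ht eps Heps.
    destruct (Dopp _ _ _ _ (profile_moment _ _ _ _ _ HB t Ht) eps Heps) as [d [Hd Hlim]].
    exists d. split; [exact Hd|]. intros s Hs. rewrite !Hflux. apply Hlim, Hs.
  + apply Hopp, (profile_forcing _ _ _ _ _ HB).
  + intros t Ht. rewrite HG by exact Ht. ring.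
  + rewrite (profile_initial_moment _ _ _ _ _ HB), (homeo_inverse_zero _ _ _ Ha Hhom). ring.
  + apply (profile_final _ _ _ _ _ HB).
Qed.

(** The lower bound on the forcing is required only for [c <= 2 * r]: for larger [c]
    concavity alone makes the mean exceed [r]. *)
Lemma profile_conclusion a Phi q g G c x w M m r R : Rbar_lt 0 a ->
  increasing_odd_homeo a Phi q -> boundary_profile q g c x w ->
  (forall t, unit_interval t -> 0 <= g t <= M) ->
  (forall t, unit_interval t -> g t = G t) ->
  0 < r <= c -> q M < R -> 8 / 3 * r < q (m / 2) ->
  (c <= 2 * r -> forall t, 0 <= t <= / 2 -> m <= g t) ->
  solves_scalar_problem a Phi G x /\ in_cone x /\ nonneg_nonzero x /\
  (ex_RInt x 0 1 /\ RInt x 0 1 > r) /\ (exists N, is_sup_norm x N /\ N < R).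
Proof.
intros Ha Hhom HB Hg HG Hr HR Hlow Hm.
pose proof (homeo_inverse_nondecreasing _ _ _ Hhom) as Hq.
pose proof (homeo_inverse_zero _ _ _ Ha Hhom) as Hq0.
pose proof (profile_in_cone _ _ _ _ _ _ Hq Hq0 HB Hg) as Hcone.
pose proof (profile_position_bounds _ _ _ _ _ _ Hq Hq0 HB Hg) as Hx.
pose proof (profile_initial _ _ _ _ _ HB) as Hc.
pose proof Hcone as [Hcont [Hnonneg [_ Hmono]]].
pose proof (ex_RInt_continuous_on_unit x 0 1 Hcont ltac:(lra) ltac:(lra) ltac:(lra)) as HI.
split; [apply (profile_solves_scalar_problem a Phi q g G c x w); assumption|].
split; [exact Hcone|]. split; [|split; [split; [exact HI|]|]].
- split; [exact Hnonneg|]. exists 0. split; [split; lra|lra].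
- destruct (Rle_lt_dec c (2 * r)) as [Hle|Hgt].
  + pose proof (profile_mean_bound _ _ _ _ _ _ m Hq Hq0 HB Hg (Hm Hle)). lra.
  + pose proof (RInt_ge_affine x 0 1 c (- c) ltac:(lra) HI) as H.
    assert (H' : forall t, 0 < t < 1 -> c + - c * t <= x t)
      by (intros t Ht; specialize (Hx t ltac:(split; lra)); lra).
    specialize (H H'). lra.
- exists (x 0). split.
  + split.
    * exists 0. split; [split; lra|]. rewrite Rabs_pos_eq; [reflexivity|]. apply Hnonneg. split; lra.
    * intros v [t [Ht ->]]. rewrite Rabs_pos_eq by (apply Hnonneg, Ht).
      apply Hmono; [split; lra|exact Ht|apply Ht].
  + rewrite Hc. pose proof (profile_initial_bound _ _ _ _ _ _ Hq HB Hg). lra.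
Qed.

(** * The theorem *)

(** Composing with the projection onto the box extends the nonlinearity from the box
    to a bounded continuous function on the plane. *)
Definition clamped_forcing (f : R -> R -> R) (R1 R2 u v : R) : R :=
  f (clamp 0 R1 u) (clamp 0 R2 v).

Lemma clamped_forcing_id f R1 R2 u v : 0 <= u <= R1 -> 0 <= v <= R2 ->
  clamped_forcing f R1 R2 u v = f u v.
Proof. intros Hu Hv. unfold clamped_forcing. rewrite !clamp_id by assumption. reflexivity. Qed.

Lemma clamped_forcing_admissible a Phi q f R1 R2 M : Rbar_lt 0 a ->
  increasing_odd_homeo a Phi q -> continuous_nonneg_on_quadrant f ->
  0 < R1 -> 0 < R2 -> is_maximum (values_on_box f 0 R1 0 R2) M ->
  admissible q (clamped_forcing f R1 R2) M.
Proof.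
intros Ha Hhom [Hcont Hnonneg] HR1 HR2 [_ HM]. constructor.
- apply (homeo_inverse_nondecreasing _ _ _ Hhom).
- apply (homeo_inverse_zero _ _ _ Ha Hhom).
- apply (homeo_inv_continuous _ _ _ Hhom).
- intros [u v].
  set (clamp2 := fun p : R * R => (clamp 0 R1 (fst p), clamp 0 R2 (snd p))).
  apply (filterlim_comp _ _ _ clamp2 (fun p : R * R => f (fst p) (snd p)) _
           (within quadrant (locally (clamp2 (u, v))))).
  + intros P [eps HP]. exists eps. intros [u' v'] [Hu Hv]. apply HP.
    * split.
      -- apply Rle_lt_trans with (1 := clamp_lipschitz 0 R1 u' u). exact Hu.
      -- apply Rle_lt_trans with (1 := clamp_lipschitz 0 R2 v' v). exact Hv.
    * split; apply Rmax_l.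
  + apply Hcont. split; apply Rmax_l.
- intros u v. pose proof (clamp_range 0 R1 u ltac:(lra)). pose proof (clamp_range 0 R2 v ltac:(lra)).
  split; [apply Hnonneg; lra|]. apply HM.
  exists (clamp 0 R1 u), (clamp 0 R2 v). repeat split; lra.
Qed.

Lemma clamp_ge l R0 u : 0 <= l <= R0 -> l <= u -> l <= clamp 0 R0 u <= R0.
Proof.
intros Hl Hu. unfold clamp. split.
- apply Rle_trans with (Rmin R0 u); [apply Rmin_glb; lra|apply Rmax_r].
- apply Rmax_lub; [lra|apply Rmin_l].
Qed.

Theorem theorem5p5
    (a1 a2 : Rbar) (ha1 : Rbar_lt 0 a1) (ha2 : Rbar_lt 0 a2)
    (Phi1 Phi2 PhiInv1 PhiInv2 : R -> R)
    (hPhi1 : increasing_odd_homeo a1 Phi1 PhiInv1)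
    (hPhi2 : increasing_odd_homeo a2 Phi2 PhiInv2)
    (f1 f2 : R -> R -> R)
    (hf1 : continuous_nonneg_on_quadrant f1)
    (hf2 : continuous_nonneg_on_quadrant f2)
    (r1 r2 R1 R2 : R)
    (hr1 : 0 < r1) (hr2 : 0 < r2) (hR1 : 0 < R1) (hR2 : 0 < R2)
    (hrR1 : 2 * r1 < R1) (hrR2 : 2 * r2 < R2)
    (m1 m2 M1 M2 : R)
    (hm1 : is_minimum (values_on_box f1 (r1 / 2) (2 * r1) (r2 / 2) R2) m1)
    (hm2 : is_minimum (values_on_box f2 (r1 / 2) R1 (r2 / 2) (2 * r2)) m2)
    (hM1 : is_maximum (values_on_box f1 0 R1 0 R2) M1)
    (hM2 : is_maximum (values_on_box f2 0 R1 0 R2) M2)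
    (hlow1 : PhiInv1 (1 / 2 * m1) > 8 / 3 * r1)
    (hlow2 : PhiInv2 (1 / 2 * m2) > 8 / 3 * r2)
    (hup1 : PhiInv1 M1 < R1)
    (hup2 : PhiInv2 M2 < R2) :
  exists x1 x2 : R -> R,
    solves_system a1 a2 Phi1 Phi2 f1 f2 x1 x2 /\
    (in_cone x1 /\ in_cone x2) /\
    (nonneg_nonzero x1 /\ nonneg_nonzero x2) /\
    (ex_RInt x1 0 1 /\ RInt x1 0 1 > r1) /\
    (ex_RInt x2 0 1 /\ RInt x2 0 1 > r2) /\
    (exists N1, is_sup_norm x1 N1 /\ N1 < R1) /\
    (exists N2, is_sup_norm x2 N2 /\ N2 < R2).
Proof.
replace (1 / 2 * m1) with (m1 / 2) in hlow1 by field.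
replace (1 / 2 * m2) with (m2 / 2) in hlow2 by field.
destruct (clamped_forcing_admissible a1 Phi1 PhiInv1 f1 R1 R2 M1) as [Q1 Z1 C1 D1 B1]; try assumption.
destruct (clamped_forcing_admissible a2 Phi2 PhiInv2 f2 R1 R2 M2) as [Q2 Z2 C2 D2 B2]; try assumption.
assert (Hf1 : forall u v, r1 / 2 <= u <= 2 * r1 -> r2 / 2 <= v -> m1 <= clamped_forcing f1 R1 R2 u v).
{ intros u v Hu Hv. apply hm1. exists (clamp 0 R1 u), (clamp 0 R2 v).
  rewrite (clamp_id 0 R1 u) by lra. split; [exact Hu|]. split; [apply clamp_ge; lra|].
  unfold clamped_forcing. rewrite (clamp_id 0 R1 u) by lra. reflexivity. }
assert (Hf2 : forall u v, r1 / 2 <= u -> r2 / 2 <= v <= 2 * r2 -> m2 <= clamped_forcing f2 R1 R2 u v).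
{ intros u v Hu Hv. apply hm2. exists (clamp 0 R1 u), (clamp 0 R2 v).
  rewrite (clamp_id 0 R2 v) by lra. split; [apply clamp_ge; lra|]. split; [exact Hv|].
  unfold clamped_forcing. rewrite (clamp_id 0 R2 v) by lra. reflexivity. }
destruct (modified_system_solvable PhiInv1 PhiInv2 (clamped_forcing f1 R1 R2) (clamped_forcing f2 R1 R2)
  M1 M2 m1 m2 r1 R1 r2 R2) as [c1 [c2 [x1 [w1 [x2 [w2 [Hc1 [Hc2 [P1 P2]]]]]]]]];
  try lra; try (constructor; assumption).
{ intros u v Hu Hv. apply Hf1; lra. }
{ intros u v Hu Hv. apply Hf2; lra. }
pose proof (profile_position_bounds _ _ _ _ _ _ Q1 Z1 P1 (fun t _ => B1 _ _)) as X1.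
pose proof (profile_position_bounds _ _ _ _ _ _ Q2 Z2 P2 (fun t _ => B2 _ _)) as X2.
assert (Y1 : forall t, unit_interval t -> envelope c1 t (x1 t) = x1 t)
  by (intros t Ht; apply Rmax_left, X1, Ht).
assert (Y2 : forall t, unit_interval t -> envelope c2 t (x2 t) = x2 t)
  by (intros t Ht; apply Rmax_left, X2, Ht).
assert (Hrange : forall t, unit_interval t -> 0 <= x1 t <= R1 /\ 0 <= x2 t <= R2).
{ intros t Ht. specialize (X1 t Ht). specialize (X2 t Ht). destruct Ht.
  assert (0 <= (1 - t) * c1) by (apply Rmult_le_pos; lra).
  assert (0 <= (1 - t) * c2) by (apply Rmult_le_pos; lra). lra. }
assert (Hearly : forall t, 0 <= t <= / 2 ->
   r1 / 2 <= envelope c1 t (x1 t) <= c1 /\ r2 / 2 <= envelope c2 t (x2 t) <= c2).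
{ intros t Ht. assert (Hu : unit_interval t) by (split; lra).
  specialize (X1 t Hu). specialize (X2 t Hu). split; apply envelope_range; lra. }
destruct (profile_conclusion a1 Phi1 PhiInv1 _ (fun t => f1 (x1 t) (x2 t)) c1 x1 w1 M1 m1 r1 R1 ha1 hPhi1 P1)
  as [S1 [K1 [N1 [I1 U1]]]]; try lra.
{ intros t _. apply B1. }
{ intros t Ht. rewrite (Y1 t Ht), (Y2 t Ht). apply clamped_forcing_id; apply (Hrange t Ht). }
{ intros Hle t Ht. specialize (Hearly t Ht). apply Hf1; lra. }
destruct (profile_conclusion a2 Phi2 PhiInv2 _ (fun t => f2 (x1 t) (x2 t)) c2 x2 w2 M2 m2 r2 R2 ha2 hPhi2 P2)
  as [S2 [K2 [N2 [I2 U2]]]]; try lra.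
{ intros t _. apply B2. }
{ intros t Ht. rewrite (Y1 t Ht), (Y2 t Ht). apply clamped_forcing_id; apply (Hrange t Ht). }
{ intros Hle t Ht. specialize (Hearly t Ht). apply Hf2; lra. }
exists x1, x2.
exact (conj (conj S1 S2) (conj (conj K1 K2) (conj (conj N1 N2) (conj I1 (conj I2 (conj U1 U2)))))).
Qed.
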